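(* Let $(X_n)_{n\ge 0}$ be a Galton--Watson process with immigration such that $X_0$ and $\varepsilon$ are regularly varying with index $\gamma \in [0,\infty)$ (the same index for both), $\mathbb{P}(\xi = 0) < 1$ and there exists $r \in (\max(1,\gamma),\infty)$ with $\mathbb{E}(\xi^r) < \infty$. Then for each $n \in \mathbb{N}$, we have $$\mathbb{P}(X_n > x) \sim m_\xi^{n\gamma}\, \mathbb{P}(X_0 > x) + \sum_{i=1}^n m_\xi^{(n-i)\gamma}\, \mathbb{P}(\varepsilon > x) \qquad \text{as } x \to \infty,$$ and hence $X_n$ is also regularly varying with index $\gamma$.
   Context: A Galton--Watson process with immigration is a stochastic process $(X_n)_{n\ge 0}$ given by $X_n = \sum_{i=1}^{X_{n-1}} \xi_{n,i} + \varepsilon_n$, $n \ge 1$, where $\{X_0, \xi_{n,i}, \varepsilon_n : n,i \ge 1\}$ are independent non-negative integer-valued random variables, the $\xi_{n,i}$ ($n,i\ge1$) are identically distributed, the $\varepsilon_n$ ($n\ge 1$) are identically distributed, and $\sum_{i=1}^0 := 0$. Here $\xi$ and $\varepsilon$ denote random variables with the distribution of $\xi_{1,1}$ and $\varepsilon_1$, respectively, and $m_\xi := \mathbb{E}(\xi)$. $\mathbb{N} = \{1,2,\ldots\}$. A non-negative random variable $X$ is regularly varying with index $\alpha \in [0,\infty)$ if $\mathbb{P}(X > x) > 0$ for all $x > 0$ and $\lim_{x\to\infty} \mathbb{P}(X > qx)/\mathbb{P}(X > x) = q^{-\alpha}$ for all $q > 0$. $f(x) \sim g(x)$ as $x\to\infty$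 means $\lim_{x\to\infty} f(x)/g(x) = 1$. *)

(* Defs.v *)
From HB Require Import structures.
From mathcomp Require Export all_boot all_order all_algebra.
From mathcomp Require Export finmap.
From mathcomp Require Export all_classical all_reals all_analysis.
Export numFieldNormedType.Exports.

Set Implicit Arguments.
Unset Strict Implicit.
Unset Printing Implicit Defensive.

Import Order.TTheory GRing.Theory Num.Theory.

Local Open Scope classical_set_scope.
Local Open Scope ring_scope.

Section Probability.
Context d (T : measurableType d) (R : realType) (P : probability T R).

Section NatToReal.
Variable X : {RV P >-> nat}.

Definition natRV (w : T) : R := (X w)%:R.

Let measurable_natRV : measurable_fun [set: T] natRV.
Proof.
exact: (@measurableT_comp _ _ _ _ _ _ (fun k : nat => k%:R : R) _ X).
Qed.

HB.instance Definition _ := isMeasurableFun.Build _ _ _ _ natRV measurable_natRV.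

End NatToReal.

Definition tail (X : {RV P >-> R}) (x : R) : R :=
  fine (ccdf X x).

Definition regularly_varying (X : {RV P >-> R}) (alpha : R) : Prop :=
  [/\ forall w, 0 <= X w,
      forall x : R, 0 < x -> 0 < tail X x
    & forall q : R, 0 < q ->
        tail X (q * x) / tail X x @[x --> +oo] --> q `^ (- alpha)].

Definition mutually_independent d' (T' : measurableType d') (I : choiceType)
    (Y : I -> {RV P >-> T'}) : Prop :=
  forall (J : {fset I}) (A : I -> set T'), (forall i, measurable (A i)) ->
    P (\bigcap_(i in [set` J]) (Y i @^-1` A i)) =
    (\prod_(i <- J) P (Y i @^-1` A i))%E.

Definition identically_distributed d' (T' : measurableType d')
    (X Y : {RV P >-> T'}) : Prop :=
  forall A, measurable A -> distribution P X A = distribution P Y A.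

Definition gwi_family (X0 : {RV P >-> nat}) (xi : nat -> nat -> {RV P >-> nat})
    (eps : nat -> {RV P >-> nat}) (k : option (nat * nat + nat)) :
    {RV P >-> nat} :=
  match k with
  | None => X0
  | Some (inl (n, i)) => xi n i
  | Some (inr n) => eps n
  end.

(* Offspring and immigration variables are indexed from 0: [xi n i] and [eps n]
   are the usual xi_{n+1,i+1} and eps_{n+1}, so [xi 0 0] and [eps 0] serve as
   the generic offspring and immigration variables. *)
Record galton_watson_immigration (X : nat -> {RV P >-> nat})
    (xi : nat -> nat -> {RV P >-> nat}) (eps : nat -> {RV P >-> nat}) : Prop := {
  gwi_independent : mutually_independent (gwi_family (X 0%N) xi eps);
  gwi_offspring : forall n i, identically_distributed (xi n i) (xi 0%N 0%N);
  gwi_immigration : forall n, identically_distributed (eps n) (eps 0%N);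
  gwi_step : forall n w,
    X n.+1 w = ((\sum_(i < X n w) xi n i w) + eps n w)%N }.

End Probability.

Arguments natRV {d T R} P X w.
Arguments tail {d T R} P X x.
Arguments regularly_varying {d T R} P X alpha.
Arguments mutually_independent {d T R} P {d' T' I} Y.
Arguments identically_distributed {d T R} P {d' T'} X Y.
Arguments galton_watson_immigration {d T R} P X xi eps.

Definition asymp_equiv (R : realType) (f g : R -> R) : Prop :=
  f x / g x @[x --> +oo] --> (1 : R).

(* Main.v *)
Require Import Defs.
From mathcomp Require Import ring lra zify measurable_realfun.
Import Order.TTheory GRing.Theory Num.Theory.
Set Implicit Arguments.
Unset Strict Implicit.
Unset Printing Implicit Defensive.
Local Open Scope classical_set_scope.
Local Open Scope ring_scope.

(** Heavy tails dominate. By induction on [n] it suffices to understand one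
generation, [X n.+1 = S (X n) + eps n], where [S k] is a sum of [k] independent
offspring variables with mean [m] and [X n] is regularly varying.

The random sum has tail [m `^ gamma * P (X n > x)], because [S k] concentrates
around [k * m] and so [S (X n) > x] happens when [X n > x / m], up to factors
close to one. For the lower bound it is enough that [S k] is rarely below
[k * m'] when [m' < m] ([partial_sum_le_le]). For the upper bound one has to see
that a number [k <= (1 - delta) * x / m] of summands seldom gives a sum above
[x]. Truncating the summands at [y = x `^ theta] with [theta < 1], an exponential
moment argument gives ([partial_sum_gt_le])
  P (S k > x) <= expR (- c * x / y) + k * P (xi > y),
where [c] is a constant depending on [delta], and Markov's inequality of order
[r] bounds the last probability by a multiple of [x `^ (- theta * r)]. Averaging
over [X n] produces the truncated mean of [X n], which is at most
[C * x `^ s * P (X n > x)] for every [s > max 1 gamma] ([regvar_dominates]).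
Since [r > max 1 gamma], one can choose [s < theta * r], and the whole
contribution is negligible ([big_jump_negligible]).

For the independent immigration, a sum of two independent variables with
regularly varying tails of the same index is large because exactly one of them
is ([indep_sum_asymp_le], [indep_sum_asymp_ge]), so that the tails add up.
Iterating [f x |-> m `^ gamma * f x + P (eps > x)] gives the stated sum.

Independence of [X n] from later generations is derived from the independence of
the underlying family by decomposing the events of [X n] into countable disjoint
unions ([fresh_comp], [indep_of_current]). *)

(** * Asymptotic comparison and regular variation *)

Section AsymptoticOrder.
Context {R : realType}.
Implicit Types (f g h : R -> R) (c q gamma : R).

(** One half of [f ~ g]. Upper and lower estimates come from different arguments,
and on nonnegative functions this relation is a preorder compatible with sums
and nonnegative multiples, so each half can be propagated through the generations on its own. *)
Definition asymp_le f g : Prop :=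
  forall e, 0 < e -> \forall x \near +oo, f x <= (1 + e) * g x.

Lemma asymp_le_trans g f h : (forall x, 0 <= h x) ->
  asymp_le f g -> asymp_le g h -> asymp_le f h.
Proof.
move=> h0 fg gh e e0.
pose a := Num.min 1 (e / 3).
have a0 : 0 < a by rewrite lt_min ltr01 divr_gt0.
have a1 : a <= 1 by rewrite ge_min lexx.
(* With [a <= 1] and [3 * a <= e], one has [(1 + a) * (1 + a) <= 1 + e]. *)
have ae : a <= e / 3 by rewrite ge_min lexx orbT.
near=> x.
have fgx : f x <= (1 + a) * g x by near: x; exact: fg.
have ghx : g x <= (1 + a) * h x by near: x; exact: gh.
have h0x := h0 x.
apply: (le_trans fgx).
have : (1 + a) * g x <= (1 + a) * ((1 + a) * h x) by rewrite ler_pM2l //; lra.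
move=> /le_trans; apply; rewrite mulrA ler_wpM2r //; nra.
Unshelve. all: by end_near. Qed.

Lemma asymp_le_near f g : (forall x, 0 <= g x) ->
  (\forall x \near +oo, f x <= g x) -> asymp_le f g.
Proof.
move=> g0 fg e e0; near=> x.
have h : f x <= g x by near: x.
have := g0 x; nra.
Unshelve. all: by end_near. Qed.

Lemma asymp_leD f1 f2 g1 g2 : asymp_le f1 g1 -> asymp_le f2 g2 ->
  asymp_le (fun x => f1 x + f2 x) (fun x => g1 x + g2 x).
Proof.
move=> h1 h2 e e0; near=> x; rewrite mulrDr lerD //.
- by near: x; exact: h1.
- by near: x; exact: h2.
Unshelve. all: by end_near. Qed.

Lemma asymp_leZ c f g : 0 <= c -> asymp_le f g ->
  asymp_le (fun x => c * f x) (fun x => c * g x).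
Proof.
move=> c0 fg e e0; near=> x; rewrite mulrCA ler_wpM2l //.
by near: x; exact: fg.
Unshelve. all: by end_near. Qed.

Lemma near_pinfty_scale (A : R -> Prop) q : 0 < q ->
  (\forall x \near +oo, A x) -> \forall x \near +oo, A (q * x).
Proof.
move=> q0 [M [_ MA]]; exists (M / q); split; first exact: num_real.
by move=> x; rewrite ltr_pdivrMr // mulrC => /MA.
Qed.

Lemma asymp_le_scale q f g : 0 < q -> asymp_le f g ->
  asymp_le (fun x => f (q * x)) (fun x => g (q * x)).
Proof.
move=> q0 fg e e0.
apply: (@near_pinfty_scale (fun x => f x <= (1 + e) * g x)) => //; exact: fg.
Qed.

(** The gap between [c'] and [c] is absorbed by the factor [1 + e], which is
why the limiting constant must be positive. *)
Lemma asymp_le_approx f g c : 0 < c -> (forall x, 0 <= g x) ->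
  (forall e, 0 < e ->
    exists2 c', c' <= (1 + e) * c & asymp_le f (fun x => c' * g x)) ->
  asymp_le f (fun x => c * g x).
Proof.
move=> c0 g0 H e e0.
pose a := Num.min 1 (e / 3).
have a0 : 0 < a by rewrite lt_min ltr01 divr_gt0.
have a1 : a <= 1 by rewrite ge_min lexx.
have ae : a <= e / 3 by rewrite ge_min lexx orbT.
have [c' c'c fc'] := H a a0.
near=> x.
have fx : f x <= (1 + a) * (c' * g x) by near: x; exact: fc'.
apply: (le_trans fx).
have gx := g0 x.
have h1 : c' * g x <= (1 + a) * c * g x by rewrite ler_wpM2r.
have h2 : (1 + a) * (c' * g x) <= (1 + a) * ((1 + a) * c * g x).
  by rewrite ler_pM2l //; lra.
apply: (le_trans h2).
have -> : (1 + a) * ((1 + a) * c * g x) = (1 + a) * (1 + a) * (c * g x) by ring.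
rewrite ler_wpM2r ?mulr_ge0 //; first exact: ltW.
nra.
Unshelve. all: by end_near. Qed.

(** Both the asymptotic equivalence of the theorem and the defining limits of
regular variation are limits of ratios; for a positive limit they amount to two
one-sided comparisons. *)
Lemma cvg_ratioP f g c : 0 < c -> (forall x, 0 < g x) ->
  (f x / g x @[x --> +oo] --> c) <->
  (asymp_le f (fun x => c * g x) /\ asymp_le (fun x => c * g x) f).
Proof.
move=> c0 g0; split.
- move=> /cvgrPdist_le H; split=> e e0.
  + near=> x.
    have : `|c - f x / g x| <= c * e by near: x; apply: H; exact: mulr_gt0.
    rewrite ler_norml => /andP[h _].
    have : f x / g x <= (1 + e) * c by lra.
    by rewrite ler_pdivrMr // mulrA.
  + near=> x.
    have : `|c - f x / g x| <= c * (e / (1 + e)).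
      by near: x; apply: H; rewrite mulr_gt0 // divr_gt0 //; lra.
    rewrite ler_norml => /andP[_ h].
    have e1 : 0 < 1 + e by lra.
    have h2 : c / (1 + e) <= f x / g x.
      have -> : c / (1 + e) = c - c * (e / (1 + e)) by field; lra.
      lra.
    by rewrite mulrC; rewrite ler_pdivrMr // mulrAC ler_pdivlMr // mulrC [f x * _]mulrC in h2.
- move=> [H1 H2]; apply/cvgrPdist_le => e e0.
  near=> x.
  have g0x := g0 x.
  have h1 : f x <= (1 + e / c) * (c * g x).
    by near: x; apply: H1; exact: divr_gt0.
  pose a := e / (c + e).
  have h2 : c * g x <= (1 + e / c) * f x by near: x; apply: H2; exact: divr_gt0.
  have k1 : f x / g x <= c + e.
    rewrite ler_pdivrMr //; apply: (le_trans h1).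
    by rewrite mulrA ler_wpM2r // ?(ltW g0x) // mulrDl mul1r divfK ?lt0r_neq0.
  have k2 : c <= (1 + e / c) * (f x / g x) by rewrite mulrA ler_pdivlMr.
  have k3 : c * c <= (c + e) * (f x / g x).
    have -> : (c + e) * (f x / g x) = c * ((1 + e / c) * (f x / g x)).
      by field; rewrite !lt0r_neq0.
    by rewrite ler_pM2l.
  rewrite ler_norml; apply/andP; split; first lra.
  move: k1 k3; set t := f x / g x => k1 k3; nra.
Unshelve. all: by end_near. Qed.

Lemma asymp_equivP f g : (forall x, 0 < g x) ->
  asymp_equiv f g <-> (asymp_le f g /\ asymp_le g f).
Proof.
move=> g0; rewrite /asymp_equiv cvg_ratioP //.
by have -> : (fun x => 1 * g x) = g by apply/funext => x; rewrite mul1r.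
Qed.

(** Positivity is required on the whole line: a tail is nonincreasing, so this is
the same as positivity on the positive half-line, and it removes all side
conditions on denominators. *)
Definition regvar f gamma : Prop := (forall x, 0 < f x) /\
  forall q, 0 < q -> f (q * x) / f x @[x --> +oo] --> q `^ (- gamma).

Lemma regvarP f gamma : (forall x, 0 < f x) -> regvar f gamma <->
  forall q, 0 < q -> asymp_le (fun x => f (q * x)) (fun x => q `^ (- gamma) * f x)
     /\ asymp_le (fun x => q `^ (- gamma) * f x) (fun x => f (q * x)).
Proof.
move=> f0; split=> [[_ H] q q0|H].
  by apply/cvg_ratioP; [exact: powR_gt0|by []|exact: H].
split=> // q q0.
by have := H q q0; rewrite -cvg_ratioP //; exact: powR_gt0.
Qed.

(** Asymptotic comparison only gives [0 < f x] for large [x]; monotonicity carries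
this to every [x]. *)
Lemma regvar_asymp f g gamma : {homo f : x y /~ x <= y} -> regvar g gamma ->
  asymp_le f g -> asymp_le g f -> regvar f gamma.
Proof.
move=> fdec [g0 gg] fg gf.
have f0 x : 0 < f x.
  have [M [_ HM]] := gf 1 ltr01.
  pose y := Num.max x (M + 1).
  have fyx : f y <= f x by apply: fdec; rewrite le_max lexx.
  have : g y <= (1 + 1) * f y by apply: HM; rewrite lt_max ltrDl ltr01 orbT.
  by have := g0 y; lra.
have f0' x : 0 <= f x by exact: ltW.
have g0' x : 0 <= g x by exact: ltW.
apply/regvarP => // q q0.
have [H1 H2] := (regvarP gamma g0).1 (conj g0 gg) q q0; split.
- apply: (asymp_le_trans (g := fun x => g (q * x))).
  + by move=> x; rewrite mulr_ge0 // powR_ge0.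
  + exact: asymp_le_scale.
  + apply: (asymp_le_trans _ H1); first by move=> x; rewrite mulr_ge0 // powR_ge0.
    by apply: asymp_leZ => //; exact: powR_ge0.
- apply: (asymp_le_trans (g := fun x => g (q * x))) => //.
  + apply: (asymp_le_trans _ _ H2) => //.
    by apply: asymp_leZ => //; exact: powR_ge0.
  + exact: asymp_le_scale.
Qed.

Lemma regvarZ c f gamma : 0 < c -> regvar f gamma ->
  regvar (fun x => c * f x) gamma.
Proof.
move=> c0 [f0 Hf]; split=> [x|q q0]; first exact: mulr_gt0.
have -> : (fun x => c * f (q * x) / (c * f x)) = (fun x => f (q * x) / f x).
  by apply/funext => x; rewrite -mulf_div divff ?mul1r // lt0r_neq0.
exact: Hf.
Qed.

Lemma regvarD f g gamma : regvar f gamma -> regvar g gamma ->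
  regvar (fun x => f x + g x) gamma.
Proof.
move=> Hf Hg; have [f0 _] := Hf; have [g0 _] := Hg.
have fg0 x : 0 < f x + g x by rewrite addr_gt0.
apply/regvarP => // q q0.
have [F1 F2] := (regvarP gamma f0).1 Hf q q0.
have [G1 G2] := (regvarP gamma g0).1 Hg q q0.
have -> : (fun x => q `^ (- gamma) * (f x + g x)) =
  (fun x => q `^ (- gamma) * f x + q `^ (- gamma) * g x).
  by apply/funext => x; rewrite mulrDr.
by split; exact: asymp_leD.
Qed.

End AsymptoticOrder.

(** * Power bounds for regularly varying functions *)

Section PowerBound.
Context {R : realType}.

Lemma gt1_ltr_powR (a x y : R) : 1 < a -> x < y -> a `^ x < a `^ y.
Proof.
move=> a1 xy; have a0 : 0 < a by lra.
by rewrite /powR gt_eqF // ltr_expR ltr_pM2r // ln_gt0.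
Qed.

Lemma invr_powR (a t : R) : 0 <= a -> a^-1 `^ t = a `^ (- t).
Proof. by move=> a0; rewrite -powR_inv1 // -powRrM mulN1r. Qed.

(** A crude substitute for the theorems of Karamata and Potter. Since
[F (x / 2) <= A * F x] for large [x], with some [A < 2 `^ s], the recursion on
[W] says that the constant [C] in [W x <= C * (x `^ s * F x)] is replaced by
[A * (2 `^ (- s) * C + 1)] when [x] doubles, and a large [C] is stable under this
map. It is used for truncated first moments, and with [W = 1] to see that [F]
decays no faster than a power. *)
Lemma regvar_dominates (F W : R -> R) (gamma s : R) :
  regvar F gamma -> {homo F : x y /~ x <= y} -> 0 <= gamma -> gamma < s -> 1 < s ->
  (forall x, 1 <= x -> W x <= x) ->
  (forall x, 1 <= x -> W x <= W (x / 2) + x * F (x / 2)) ->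
  exists2 C, 0 < C & \forall x \near +oo, W x <= C * (x `^ s * F x).
Proof.
move=> [F0 rvF] Fdec g0 gs s1 Wx Wrec.
have p2 (t : R) : 0 < (2 : R) `^ t by apply: powR_gt0.
pose A := ((2 : R) `^ gamma + 2 `^ s) / 2.
have AS : A < 2 `^ s.
  have : (2 : R) `^ gamma < 2 `^ s by apply: gt1_ltr_powR => //; rewrite ltr1n.
  rewrite /A; lra.
have GA : (2 : R) `^ gamma < A.
  have : (2 : R) `^ gamma < 2 `^ s by apply: gt1_ltr_powR => //; rewrite ltr1n.
  rewrite /A; lra.
have A0 : 0 < A by apply: lt_trans GA.
have : \forall x \near +oo, F (x / 2) <= A * F x.
  have := rvF 2^-1 _.
  rewrite invr_gt0 ltr0n => /(_ isT) /cvgrPdist_le H.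
  have := H (A - 2 `^ gamma); rewrite subr_gt0 => /(_ GA) K.
  near=> x.
  have : `|2^-1 `^ (- gamma) - F (2^-1 * x) / F x| <= A - 2 `^ gamma by near: x.
  rewrite invr_powR // opprK ler_norml => /andP[h _].
  have : F (2^-1 * x) / F x <= A by lra.
  by rewrite ler_pdivrMr // mulrC.
move=> [M [_ HM]].
pose y0 := Num.max 1 (M + 1).
have y1 : 1 <= y0 by rewrite le_max lexx.
have yM x : y0 <= x -> M < x.
  by move=> h; apply: lt_le_trans h; rewrite lt_max ltrDl ltr01 orbT.
have A2 : A * 2 `^ (- s) < 1.
  by rewrite powRN ltr_pdivrMr // mul1r.
(* The first entry makes [C] stable under doubling, the second one makes the bound
hold on the initial interval from [y0] to [2 * y0]. *)
pose C := Num.max (A / (1 - A * 2 `^ (- s))) (2 * y0 / F (2 * y0)).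
have C0 : 0 < C.
  rewrite lt_max; apply/orP; right; rewrite divr_gt0 //; lra.
have x1s x : 1 <= x -> x <= x `^ s.
  move=> x1; rewrite -[leLHS]powRr1; last lra.
  by rewrite ler_powR // ltW.
have base x : y0 <= x -> x <= 2 * y0 -> W x <= C * (x `^ s * F x).
  move=> yx xy.
  have x1 : 1 <= x by apply: le_trans yx.
  apply: (@le_trans _ _ (C * F (2 * y0))).
    apply: (@le_trans _ _ (2 * y0)); first by apply: le_trans (Wx _ x1) xy.
    by rewrite -ler_pdivrMr // le_max lexx orbT.
  rewrite ler_pM2l //; apply: (le_trans (Fdec _ _ xy)).
  by rewrite ler_peMl ?(ltW (F0 _)) //; apply: le_trans (x1s _ x1).
have ind n : forall x, y0 <= x -> x <= 2 ^+ n * y0 -> W x <= C * (x `^ s * F x).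
  elim: n => [|n IH] x yx xy.
    by apply: base => //; apply: le_trans xy _; rewrite expr0 mul1r; lra.
  have [|x2] := leP x (2 * y0); first exact: base.
  have x1 : 1 <= x by apply: le_trans yx.
  have x0 : 0 < x by lra.
  have hx : W (x / 2) <= C * ((x / 2) `^ s * F (x / 2)).
    apply: IH; first lra.
    by move: xy; rewrite exprS; lra.
  apply: (le_trans (Wrec _ x1)).
  have Fx : F (x / 2) <= A * F x by apply: HM; exact: yM.
  have e1 : (x / 2) `^ s = x `^ s * 2 `^ (- s).
    by rewrite powRM ?invr_ge0 ?invr_powR //; lra.
  apply: (@le_trans _ _ ((C * 2 `^ (- s) + 1) * x `^ s * F (x / 2))).
    apply: (le_trans (lerD hx (lexx _))).
    rewrite e1 mulrA -mulrDl ler_pM2r //.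
    by have := x1s x x1; lra.
  apply: (@le_trans _ _ ((C * 2 `^ (- s) + 1) * x `^ s * (A * F x))).
    rewrite ler_wpM2l // mulr_ge0 ?powR_ge0 // addr_ge0 // mulr_ge0 ?powR_ge0 //.
    exact: ltW.
  have -> : (C * 2 `^ (- s) + 1) * x `^ s * (A * F x) =
     (A + C * (A * 2 `^ (- s))) * (x `^ s * F x) by ring.
  rewrite ler_wpM2r ?mulr_ge0 ?powR_ge0 ?(ltW (F0 _)) //.
  have hC : A / (1 - A * 2 `^ (- s)) <= C by rewrite le_max lexx.
  move: hC; rewrite ler_pdivrMr; last by rewrite subr_gt0.
  lra.
exists C => //; near=> x.
have yx : y0 <= x by near: x; apply: nbhs_pinfty_ge; exact: num_real.
have [n xn] : exists n, x <= 2 ^+ n * y0.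
  exists (Num.trunc x).+1.
  apply: (@le_trans _ _ (Num.trunc x).+1%:R); first exact: ltW (truncnS_gt _).
  apply: (@le_trans _ _ (2 ^+ (Num.trunc x).+1)).
    by rewrite -natrX ler_nat ltnW //; exact: ltn_expl.
  by rewrite ler_peMr // exprn_ge0.
exact: ind xn.
Unshelve. all: by end_near. Qed.

End PowerBound.

Section PowerDecay.
Context {R : realType}.
Implicit Types (e s t b gamma : R).

Lemma near_powR_le (k e : R) : k < 0 -> 0 < e -> \forall x \near +oo, x `^ k <= e.
Proof.
move=> k0 e0; near=> x.
have x0 : 0 < x by near: x; apply: nbhs_pinfty_gt; exact: num_real.
have xe : e `^ k^-1 <= x by near: x; apply: nbhs_pinfty_ge; exact: num_real.
have -> : k = - - k by rewrite opprK.
rewrite powRN -[leRHS]invrK lef_pV2 ?posrE ?invr_gt0 ?powR_gt0 //.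
apply: (@le_trans _ _ ((e `^ k^-1) `^ (- k))).
  by rewrite -powRrM mulrN mulVf ?ltr0_neq0 // powR_inv1 // ltW.
by rewrite ge0_ler_powR ?nnegrE ?powR_ge0 ?(ltW x0) // oppr_ge0 ltW.
Unshelve. all: by end_near. Qed.

(** One term of the exponential series, of order [n.+1 > s / t], beats [x `^ s]. *)
Lemma near_expR_powR_le b t s e : 0 < b -> 0 < t -> 0 < e ->
  \forall x \near +oo, expR (- (b * x `^ t)) * x `^ s <= e.
Proof.
move=> b0 t0 e0.
pose n := Num.trunc (s / t).
have nt : s - t * n.+1%:R < 0.
  by rewrite subr_lt0 mulrC -ltr_pdivrMr //; exact: truncnS_gt.
pose c := n.+1`!%:R / b ^+ n.+1.
have c0 : 0 < c by rewrite divr_gt0 ?exprn_gt0 // ltr0n fact_gt0.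
near=> x.
have x0 : 0 < x by near: x; apply: nbhs_pinfty_gt; exact: num_real.
have small : x `^ (s - t * n.+1%:R) <= e / c.
  by near: x; apply: near_powR_le => //; exact: divr_gt0.
have bx : 0 < b * x `^ t by rewrite mulr_gt0 // powR_gt0.
have H : expR (- (b * x `^ t)) <= c / x `^ (t * n.+1%:R).
  rewrite expRN powRrM powR_mulrn ?powR_ge0 //.
  have := expR_ge1Dxn n (ltW bx); rewrite exprMn => H.
  rewrite -invf_div lef_pV2 ?posrE ?expR_gt0 //; last first.
    by rewrite divr_gt0 // exprn_gt0 // powR_gt0.
  by rewrite /c invf_div mulrA [X in X / _]mulrC; lra.
apply: (le_trans (ler_wpM2r (powR_ge0 _ _) H)).
rewrite mulrAC -mulrA -powRB; last by rewrite (gt_eqF x0) implybT.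
by rewrite mulrC -ler_pdivlMr.
Unshelve. all: by end_near. Qed.

(** The factors [u] and [u^-1] play the role of the usual [1 + delta] and
[1 - delta]; the lemma bounds what they cost in a regularly varying tail. *)
Lemma exists_powR_le gamma e : 0 <= gamma -> 0 < e ->
  exists2 u, 1 < u & u `^ gamma <= 1 + e.
Proof.
move=> g0 e0; have g1 : 0 < gamma + 1 by lra.
exists ((1 + e) `^ (gamma + 1)^-1).
  rewrite -[ltLHS](powRr0 (1 + e)); apply: gt1_ltr_powR; first lra.
  by rewrite invr_gt0.
rewrite -powRrM -[leRHS]powRr1; last lra.
by apply: ler_powR; [lra|rewrite mulrC ler_pdivrMr; lra].
Qed.

End PowerDecay.

(** * Probabilities of events as real numbers *)

Section RealProbability.
Context {d : measure_display} {T : measurableType d} {R : realType}.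
Variable P : probability T R.
Implicit Types (A B : set T).

Definition pr A : R := fine (P A).

Lemma prE A : measurable A -> P A = (pr A)%:E.
Proof. by move=> mA; rewrite /pr fineK // fin_num_measure. Qed.

Lemma pr_ge0 A : 0 <= pr A.
Proof. by apply: fine_ge0; exact: measure_ge0. Qed.

Lemma pr_le1 A : measurable A -> pr A <= 1.
Proof. by move=> mA; rewrite -lee_fin -prE //; exact: probability_le1. Qed.

Lemma le_pr A B : measurable A -> measurable B -> A `<=` B -> pr A <= pr B.
Proof.
by move=> mA mB AB; rewrite -lee_fin -!prE //; apply: le_measure; rewrite ?inE.
Qed.

Lemma prC A : measurable A -> pr (~` A) = 1 - pr A.
Proof.
move=> mA; apply: EFin_inj; rewrite -prE; last exact: measurableC.
by rewrite probability_setC // prE.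
Qed.

Lemma prU A B : measurable A -> measurable B -> A `&` B = set0 ->
  pr (A `|` B) = pr A + pr B.
Proof.
move=> mA mB AB; apply: EFin_inj; rewrite -prE; last exact: measurableU.
by rewrite measureU // EFinD -!prE.
Qed.

Lemma pr_leU A B : measurable A -> measurable B -> pr (A `|` B) <= pr A + pr B.
Proof.
move=> mA mB; rewrite -lee_fin -prE; last exact: measurableU.
by rewrite EFinD -!prE //; exact: measureU2.
Qed.

Lemma prI A B : measurable A -> measurable B -> P (A `&` B) = (P A * P B)%E ->
  pr (A `&` B) = pr A * pr B.
Proof.
move=> mA mB AB; apply: EFin_inj; rewrite -prE; last exact: measurableI.
by rewrite AB EFinM -!prE.
Qed.

(** In the large deviation bounds below the values of the variables that
matter are bounded in terms of the threshold, so finite covers suffice, also for random sums. *)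
Lemma pr_le_cover A B n (C : nat -> set T) : measurable A -> measurable B ->
  (forall j, measurable (C j)) ->
  A `<=` B `|` [set w | exists2 j, (j < n)%N & C j w] ->
  pr A <= pr B + \sum_(0 <= j < n) pr (C j).
Proof.
move=> mA mB mC; elim: n A mA => [|n IH] A mA AB.
  rewrite big_geq // addr0; apply: le_pr => // w Aw.
  by case: (AB w Aw) => [//|[j]].
rewrite big_nat_recr //= addrA.
have mAC : measurable (A `\` C n) by exact: measurableD.
apply: (@le_trans _ _ (pr ((A `\` C n) `|` C n))).
  apply: le_pr => //; first exact: measurableU.
  by move=> w Aw; have [Cw|Cw] := pselect (C n w); [right|left].
apply: (le_trans (pr_leU mAC (mC n))); rewrite lerD2r.
apply: IH => // w [Aw Cw].
case: (AB w Aw) => [|[j jn Cj]]; first by left.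
right; exists j => //; move: jn; rewrite ltnS leq_eqVlt => /orP[/eqP jn|//].
by rewrite jn in Cj.
Qed.

Definition nat_measurable (Z : T -> nat) := forall A : set nat, measurable (Z @^-1` A).

Lemma sum_pr_eq (Z : T -> nat) J n : nat_measurable Z -> (J <= n)%N ->
  \sum_(J <= k < n) pr (Z @^-1` [set k]) = pr (Z @^-1` [set k | (J <= k < n)%N]).
Proof.
move=> mZ; elim: n => [|n IH] Jn.
  rewrite big_geq // (_ : [set _ | _] = set0); last first.
    by apply/seteqP; split => // k /=; rewrite andbF.
  by rewrite preimage_set0 /pr measure0.
move: Jn; rewrite leq_eqVlt => /orP[/eqP <-|Jn].
  rewrite big_geq // (_ : [set _ | _] = set0); last first.
    by apply/seteqP; split => // k /=; lia.
  by rewrite preimage_set0 /pr measure0.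
rewrite big_nat_recr //= IH // -prU //.
  congr pr; apply/seteqP; split=> w /=; first by move=> [|->]; lia.
  move=> H; have [->|H2] := eqVneq (Z w) n; [by right|left; lia].
by apply/seteqP; split => w //= [H1 H2]; lia.
Qed.

Lemma sum_pr_le (Z : T -> nat) J n : nat_measurable Z ->
  \sum_(J <= k < n) pr (Z @^-1` [set k]) <= pr (Z @^-1` [set k | (J <= k)%N]).
Proof.
move=> mZ; have [Jn|nJ] := leqP J n; last by rewrite big_geq ?pr_ge0 // ltnW.
by rewrite sum_pr_eq //; apply: le_pr => // w /= /andP[].
Qed.

Lemma sum_pr_le1 (Z : T -> nat) J n : nat_measurable Z ->
  \sum_(J <= k < n) pr (Z @^-1` [set k]) <= 1.
Proof. by move=> mZ; apply: le_trans (sum_pr_le _ _ mZ) (pr_le1 _). Qed.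

End RealProbability.

(** * Independence between generations *)

Section PartialSum.
Context {T : Type}.
Variable xi : nat -> T -> nat.

Definition partial_sum k w : nat := (\sum_(i < k) xi i w)%N.

Lemma partial_sum0 w : partial_sum 0 w = 0%N.
Proof. by rewrite /partial_sum big_ord0. Qed.

Lemma partial_sumS k :
  partial_sum k.+1 = fun w => (partial_sum k w + xi k w)%N.
Proof. by apply/funext => w; rewrite /partial_sum big_ord_recr. Qed.

End PartialSum.

Section IndependentEvents.
Context {d : measure_display} {T : measurableType d} {R : realType}.
Context {P : probability T R} {I : choiceType} (Y : I -> {RV P >-> nat}).
Implicit Types (K : set I) (E : set T) (Z : T -> nat).

(** All variables are discrete, so no generated sigma-algebra is needed: it is
enough to follow single events [E] together with the set [K] of indices of the
variables that have not been used in building [E]. *)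
Definition indep_of K E : Prop := measurable E /\
  forall (J : {fset I}) (A : I -> set nat), [set` J] `<=` K ->
    P (E `&` \bigcap_(i in [set` J]) (Y i @^-1` A i)) =
    (P E * \prod_(i <- J) P (Y i @^-1` A i))%E.

Lemma measurable_preimage_nat (Z : {RV P >-> nat}) (A : set nat) :
  measurable (Z @^-1` A).
Proof. by rewrite -[X in measurable X]setTI; exact: measurable_funPT. Qed.

Lemma indep_of_subset K K' E : K' `<=` K -> indep_of K E -> indep_of K' E.
Proof. by move=> KK [mE H]; split=> // J A JK; apply: H => i /JK /KK. Qed.

Lemma indep_ofT : mutually_independent P Y -> indep_of setT setT.
Proof.
move=> H; split=> // J A _; rewrite setTI probability_setT mul1e.
exact: H.
Qed.

Lemma indep_of_set0 K : indep_of K set0.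
Proof. by split=> // J A _; rewrite set0I measure0 mul0e. Qed.

Lemma indep_of_var K E k (B : set nat) : indep_of K E -> K k ->
  P (E `&` Y k @^-1` B) = (P E * P (Y k @^-1` B))%E.
Proof.
move=> [mE H] Kk; have := H [fset k]%fset (fun=> B).
rewrite big_seq_fset1 set_fset1 bigcap_set1; apply.
by move=> i ->.
Qed.

(** The new constraint on [Y k] is absorbed in the finite family: test [E] against
the family indexed by [k |` J]. *)
Lemma indep_of_setI K E k (B : set nat) : indep_of K E -> K k ->
  indep_of (K `\ k) (E `&` Y k @^-1` B).
Proof.
move=> HE Kk; have [mE H] := HE; split.
  by apply: measurableI => //; exact: measurable_preimage_nat.
move=> J A JK; rewrite (indep_of_var _ HE Kk).
have kJ : k \notin J by apply/negP => /JK [_]; apply.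
pose A' i := if i == k then B else A i.
have A'J i : [set` J] i -> A' i = A i.
  by move=> Ji; rewrite /A'; case: eqP => // ik; move: kJ; rewrite -ik Ji.
have -> : \bigcap_(i in [set` J]) (Y i @^-1` A i) =
          \bigcap_(i in [set` J]) (Y i @^-1` A' i).
  by apply: eq_bigcapr => i Ji; rewrite A'J.
have -> : (\prod_(i <- J) P (Y i @^-1` A i) =
           \prod_(i <- J) P (Y i @^-1` A' i))%E.
  by apply: eq_big_seq => i Ji; rewrite A'J.
have -> : B = A' k by rewrite /A' eqxx.
rewrite -setIA -muleA -(big_fsetU1 _ (fun i => P (Y i @^-1` A' i))) //.
rewrite -H; last by move=> i; rewrite /= !inE => /orP[/eqP ->//|/JK []].
by rewrite set_fsetU set_fset1 bigcap_setU bigcap_set1.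
Qed.

Lemma bigcup_scale (F G : nat -> set T) (c : \bar R) : c \is a fin_num ->
  (forall i, measurable (F i)) -> (forall i, measurable (G i)) ->
  trivIset setT F -> trivIset setT G -> (forall i, P (F i) = c * P (G i))%E ->
  (P (\bigcup_i F i) = c * P (\bigcup_i G i))%E.
Proof.
move=> cfin mF mG tF tG FG; rewrite !measure_bigcup // -(fineK cfin).
rewrite -nneseriesZl //; apply: eq_eseriesr => i _.
by rewrite fineK //; exact: FG.
Qed.

Lemma indep_of_bigcup K (F : nat -> set T) : trivIset setT F ->
  (forall i, indep_of K (F i)) -> indep_of K (\bigcup_i F i).
Proof.
move=> tF HF; split; first by apply: bigcupT_measurable => i; exact: (HF i).1.
move=> J A JK; rewrite setI_bigcupl muleC; apply: bigcup_scale => //.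
- rewrite big_seq; elim/big_ind: _ => //; first exact: fin_numM.
  by move=> i _; apply: fin_num_measure; exact: measurable_preimage_nat.
- move=> i; apply: measurableI; first exact: (HF i).1.
  by apply: fin_bigcap_measurable => // j _; exact: measurable_preimage_nat.
- by move=> i; exact: (HF i).1.
- exact: trivIset_setIr.
- by move=> i; rewrite (HF i).2 // muleC.
Qed.

(** Events about [Z], even intersected with [E], do not involve the variables
indexed by [K], and [Z] is independent of [E]. This is the invariant kept while the
variables of one generation are added to [Z] one after the other. *)
Definition fresh K E Z : Prop := forall B : set nat,
  [/\ indep_of K (Z @^-1` B), indep_of K (E `&` Z @^-1` B) &
      (P (E `&` Z @^-1` B) = P E * P (Z @^-1` B))%E].

Lemma preimage_comp2 Z (U : T -> nat) (h : nat -> nat -> nat) (B : set nat) :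
  (fun w => h (Z w) (U w)) @^-1` B =
  \bigcup_t ((Z @^-1` [set t]) `&` U @^-1` (h t @^-1` B)).
Proof.
apply/seteqP; split=> w /=; first by move=> Bw; exists (Z w).
by move=> [t _ [/= <-]].
Qed.

Lemma trivIset_preimage Z (V : nat -> set T) :
  trivIset setT (fun t => (Z @^-1` [set t]) `&` V t).
Proof. by move=> i j _ _ [w [[/= <- _] [/= <- _]]]. Qed.

(** Split according to the countably many values of [Z]; on each piece, [Y k] is
constrained by a condition that does not depend on [Z] any more. *)
Lemma fresh_comp K E Z k (h : nat -> nat -> nat) : measurable E ->
  fresh K E Z -> K k ->
  fresh (K `\ k) E (fun w => h (Z w) (Y k w)).
Proof.
move=> mE HZ Kk B; rewrite preimage_comp2 setI_bigcupr.
have tri := @trivIset_preimage Z (fun t => Y k @^-1` (h t @^-1` B)).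
have ind1 t : indep_of (K `\ k) (Z @^-1` [set t] `&` Y k @^-1` (h t @^-1` B)).
  by apply: indep_of_setI => //; case: (HZ [set t]).
have ind2 t : indep_of (K `\ k)
    (E `&` (Z @^-1` [set t] `&` Y k @^-1` (h t @^-1` B))).
  by rewrite setIA; apply: indep_of_setI => //; case: (HZ [set t]).
have tri2 : trivIset setT
    (fun t => E `&` (Z @^-1` [set t] `&` Y k @^-1` (h t @^-1` B))).
  exact: trivIset_setIl.
split.
- exact: indep_of_bigcup.
- exact: indep_of_bigcup.
- apply: bigcup_scale => //.
  + exact: fin_num_measure.
  + by move=> i; exact: (ind2 i).1.
  + by move=> i; exact: (ind1 i).1.
  + move=> t; have [i1 i2 e] := HZ [set t].
    by rewrite setIA (indep_of_var _ i2) // e (indep_of_var _ i1) // muleA.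
Qed.

End IndependentEvents.

Section GenerationIndependence.
Context {d : measure_display} {T : measurableType d} {R : realType}.
Context {P : probability T R}.
Variables (X : nat -> {RV P >-> nat}) (xi : nat -> nat -> {RV P >-> nat}).
Variable eps : nat -> {RV P >-> nat}.
Hypothesis hX : galton_watson_immigration P X xi eps.

Local Notation Y := (gwi_family (X 0%N) xi eps).

(** The variables that are still unused when [X n] and the first [j] offspring
variables of generation [n] have been revealed. *)
Definition future n (j : nat) : set (option (nat * nat + nat)) := fun k =>
  match k with
  | None => False
  | Some (inl (m, i)) => (n < m)%N \/ m = n /\ (j <= i)%N
  | Some (inr m) => (n <= m)%N
  end.

Lemma fresh_offspring_sum n E k : indep_of Y (future n 0) E ->
  fresh Y (future n k) E (partial_sum (xi n) k).
Proof.
move=> HE; have mE := HE.1; elim: k => [|k IH].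
  have triv (B : set nat) : partial_sum (xi n) 0 @^-1` B = setT \/
                            partial_sum (xi n) 0 @^-1` B = set0.
    have e w : partial_sum (xi n) 0 w = 0%N by exact: partial_sum0.
    have [B0|B0] := pselect (B 0%N); [left|right].
      by apply/seteqP; split => // w _; rewrite /= e.
    by apply/seteqP; split => // w /=; rewrite e.
  move=> B; case: (triv B) => ->; rewrite ?setIT ?setI0 ?probability_setT.
    split=> //; last by rewrite mule1.
    apply: indep_of_subset (@subsetT _ _) _; apply: indep_ofT.
    exact: gwi_independent hX.
  by rewrite measure0 mule0; split=> //; exact: indep_of_set0.
rewrite partial_sumS => B.
have := @fresh_comp _ _ _ _ _ Y _ _ _ (Some (inl (n, k))) addn mE IH _ B.
case; first by right.
have sub : future n k.+1 `<=` future n k `\ Some (inl (n, k)).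
  move=> [[[m i]|m]|] //= H; split=> //; case: H => [nm|[mn ki]].
  - by left.
  - by right; split=> //; lia.
  - by case=> ? _; lia.
  - by case=> _ ?; lia.
move=> h1 h2 h3; split => //.
- exact: indep_of_subset sub h1.
- exact: indep_of_subset sub h2.
Qed.

(** Given [X n = b], the next generation size is a sum of a fixed number of
variables from the future, and the event is the disjoint union over [b]. *)
Lemma indep_of_current n : forall B, indep_of Y (future n 0) (X n @^-1` B).
Proof.
elim: n => [|n IH] B.
  have h : indep_of Y (setT `\ None) (setT `&` Y None @^-1` B).
    by apply: indep_of_setI => //; apply: indep_ofT; exact: gwi_independent hX.
  rewrite setTI in h; apply: indep_of_subset h.
  by move=> [[[m i]|m]|].
have -> : X n.+1 @^-1` B = \bigcup_b ((X n @^-1` [set b]) `&`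
    (fun w => partial_sum (xi n) b w + eps n w)%N @^-1` B).
  apply/seteqP; split=> w /=.
    by rewrite (gwi_step hX); exists (X n w).
  by move=> [b _ [/= <-]]; rewrite (gwi_step hX).
apply: indep_of_bigcup; first exact: trivIset_preimage.
move=> b; have fr := fresh_offspring_sum b (IH [set b]).
have := @fresh_comp _ _ _ _ _ Y _ _ _ (Some (inr n)) addn (IH _).1 fr _ B.
case; first exact: leqnn.
move=> _ h _; apply: indep_of_subset h => -[[[m i]|m]|] //=.
- by move=> [nm|[-> _]]; split=> //; left; lia.
- by move=> nm; split; [lia|case; lia].
Qed.

Lemma current_offspring_indep n k (A B : set nat) :
  P (X n @^-1` A `&` partial_sum (xi n) k @^-1` B) =
  (P (X n @^-1` A) * P (partial_sum (xi n) k @^-1` B))%E.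
Proof.
by have [_ _] := fresh_offspring_sum k (indep_of_current n A) B.
Qed.

Lemma measurable_offspring_sum n k (B : set nat) :
  measurable (partial_sum (xi n) k @^-1` B).
Proof. by have [[]] := fresh_offspring_sum k (indep_of_current n setT) B. Qed.

Lemma offspring_sum_indep n k (A B : set nat) :
  P (partial_sum (xi n) k @^-1` A `&` xi n k @^-1` B) =
  (P (partial_sum (xi n) k @^-1` A) * P (xi n k @^-1` B))%E.
Proof.
have [h _ _] := fresh_offspring_sum k (indep_of_current n setT) A.
by apply: (indep_of_var (k := Some (inl (n, k))) B h); right.
Qed.

Definition random_sum n w : nat := partial_sum (xi n) (X n w) w.

Lemma indep_of_random_sum n (A : set nat) :
  indep_of Y [set Some (inr n)] (random_sum n @^-1` A).
Proof.
have -> : random_sum n @^-1` A =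
    \bigcup_b ((X n @^-1` [set b]) `&` partial_sum (xi n) b @^-1` A).
  apply/seteqP; split=> w /=; first by exists (X n w).
  by move=> [b _ [/= <-]].
apply: indep_of_bigcup; first exact: trivIset_preimage.
move=> b; have [_ h _] := fresh_offspring_sum b (indep_of_current n [set b]) A.
by apply: indep_of_subset h => _ ->; exact: leqnn.
Qed.

Lemma measurable_random_sum n (A : set nat) : measurable (random_sum n @^-1` A).
Proof. by have [] := indep_of_random_sum n A. Qed.

Lemma random_sum_immigration_indep n (A B : set nat) :
  P (random_sum n @^-1` A `&` eps n @^-1` B) =
  (P (random_sum n @^-1` A) * P (eps n @^-1` B))%E.
Proof.
exact: (indep_of_var (k := Some (inr n)) B (indep_of_random_sum n A) erefl).
Qed.

End GenerationIndependence.

(** * Exponential bounds for partial sums *)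

Section Chernoff.
Context {d : measure_display} {T : measurableType d} {R : realType}.
Variable P : probability T R.
Variables (xi : nat -> T -> nat) (xi0 : T -> nat).

Local Notation S := (partial_sum xi).

Hypothesis mxi0 : nat_measurable xi0.
Hypothesis mxi : forall k, nat_measurable (xi k).
Hypothesis mS : forall k, nat_measurable (S k).
Hypothesis xi_law : forall k A, pr P (xi k @^-1` A) = pr P (xi0 @^-1` A).
Hypothesis S_indep : forall k A B,
  pr P (S k @^-1` A `&` xi k @^-1` B) =
  pr P (S k @^-1` A) * pr P (xi k @^-1` B).

Local Notation p j := (pr P (xi0 @^-1` [set j])).

(** The exponential Markov inequality, by induction on the number of summands
instead of an expectation of a product: conditioning on the last summand only
involves its values [j <= x], so partial sums of the Laplace transform suffice. *)
Lemma chernoff_le (l M : R) : 0 <= l -> 0 <= M ->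
  (forall n, \sum_(0 <= j < n) p j * expR (- (l * j%:R)) <= M) ->
  forall k x, pr P (S k @^-1` [set s | s%:R <= x]) <= expR (l * x) * M ^+ k.
Proof.
move=> l0 M0 HM; elim=> [|k IH] x.
  rewrite expr0 mulr1; have [x0|x0] := leP 0 x.
    apply: (@le_trans _ _ 1); first by apply: pr_le1; exact: mS.
    by rewrite -expR0 ler_expR mulr_ge0.
  rewrite (_ : _ @^-1` _ = set0) ?/pr ?measure0 ?expR_ge0 //.
  by apply/seteqP; split => // w /=; rewrite partial_sum0 leNgt x0.
pose C j := S k @^-1` [set s | s%:R <= x - j%:R] `&` xi k @^-1` [set j].
have mC j : measurable (C j) by apply: measurableI; [exact: mS|exact: mxi].
pose n := (Num.trunc x).+1.
apply: (@le_trans _ _ (pr P set0 + \sum_(0 <= j < n) pr P (C j))).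
  apply: pr_le_cover => //; first exact: mS.
  move=> w /=; rewrite partial_sumS natrD => H; right; exists (xi k w).
    rewrite /n -(ltr_nat R); apply: le_lt_trans (truncnS_gt _).
    by apply: le_trans H; rewrite lerDr.
  by split => //=; lra.
rewrite {1}/pr measure0 add0r.
apply: (@le_trans _ _ (\sum_(0 <= j < n)
    (expR (l * x) * M ^+ k) * (p j * expR (- (l * j%:R))))).
  apply: ler_sum => j _; rewrite /C S_indep xi_law.
  apply: (le_trans (ler_wpM2r (pr_ge0 _ _) (IH _))).
  rewrite mulrBr expRD [leLHS]mulrC.
  set a := expR _; set b := expR _; set c := pr _ _; set e := _ ^+ _.
  by have -> : c * (a * b * e) = a * e * (c * b) by ring.
by rewrite -mulr_sumr exprSr mulrA ler_wpM2l // mulr_ge0 ?expR_ge0 ?exprn_ge0.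
Qed.

(** Truncation and the exponential Markov inequality in one induction: a summand at
least [n] is paid for by the last term, and the other summands only see the
truncated exponential moment [M]. *)
Lemma chernoff_gt (l M : R) n : 0 <= l -> 0 <= M ->
  \sum_(0 <= j < n) p j * expR (l * j%:R) <= M ->
  forall k x, pr P (S k @^-1` [set s | x < s%:R]) <=
    expR (- (l * x)) * M ^+ k + k%:R * pr P (xi0 @^-1` [set j | (n <= j)%N]).
Proof.
move=> l0 M0 HM; elim=> [|k IH] x.
  rewrite expr0 mulr1 mul0r addr0; have [x0|x0] := ltP x 0.
    apply: (@le_trans _ _ 1); first by apply: pr_le1; exact: mS.
    rewrite -expR0 ler_expR; nra.
  rewrite (_ : _ @^-1` _ = set0) ?/pr ?measure0 ?expR_ge0 //.
  by apply/seteqP; split => // w /=; rewrite partial_sum0 ltNge x0.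
pose C j := S k @^-1` [set s | x - j%:R < s%:R] `&` xi k @^-1` [set j].
have mC j : measurable (C j) by apply: measurableI; [exact: mS|exact: mxi].
set t := pr P (xi0 @^-1` _).
have t0 : 0 <= t by exact: pr_ge0.
apply: (@le_trans _ _ (pr P (xi k @^-1` [set j | (n <= j)%N]) +
    \sum_(0 <= j < n) pr P (C j))).
  apply: pr_le_cover => //; [exact: mS|exact: mxi|].
  move=> w /=; rewrite partial_sumS natrD => H.
  have [nx|xn] := leqP n (xi k w); [by left|right; exists (xi k w) => //].
  by split => //=; lra.
rewrite xi_law -/t.
have : \sum_(0 <= j < n) pr P (C j) <=
    (\sum_(0 <= j < n) (expR (- (l * x)) * M ^+ k) * (p j * expR (l * j%:R))) +
    \sum_(0 <= j < n) (k%:R * t) * p j.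
  rewrite -big_split /=; apply: ler_sum => j _; rewrite /C S_indep xi_law.
  apply: (le_trans (ler_wpM2r (pr_ge0 _ _) (IH _))).
  rewrite mulrBr opprB addrC expRD -/t.
  set a := expR _; set b := expR _; set c := pr _ _; set e := _ ^+ _.
  rewrite le_eqVlt; apply/orP; left; apply/eqP; ring.
rewrite -!mulr_sumr => H.
have h1 : (k%:R * t) * \sum_(0 <= j < n) p j <= k%:R * t.
  by rewrite ler_piMr ?mulr_ge0 ?ler0n //; exact: sum_pr_le1.
have h2 : expR (- (l * x)) * M ^+ k * \sum_(0 <= j < n) p j * expR (l * j%:R)
    <= expR (- (l * x)) * M ^+ k.+1.
  by rewrite exprSr mulrA ler_wpM2l // mulr_ge0 ?expR_ge0 ?exprn_ge0.
rewrite -[k.+1%:R]natr1 mulrDl mul1r; lra.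
Qed.

Variable m : R.
Hypothesis m_ge : forall n, \sum_(0 <= j < n) p j * j%:R <= m.
Hypothesis m_lim : forall m', m' < m -> exists n, m' < \sum_(0 <= j < n) p j * j%:R.

Lemma expR_le_div1B (u : R) : u < 1 -> expR u <= (1 - u)^-1.
Proof.
move=> u1; rewrite -[expR u]invrK -expRN lef_pV2 ?posrE ?expR_gt0 ?subr_gt0 //.
exact: expR_ge1Dx.
Qed.

Lemma mean_ge0 : 0 <= m.
Proof. by have := m_ge 0; rewrite big_geq. Qed.

(** If [k] summands have total mean at most [(1 - delta) * x], their sum exceeds [x]
essentially only through one summand larger than [y]. With the exponent
[l = delta / (2 * y)], linearizing the exponential bounds the truncated
exponential moment by [expR (l * m / (1 - delta / 2))], so that only the first
moment enters, and the gain [1 - (1 - delta) / (1 - delta / 2)] remains. *)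
Lemma partial_sum_gt_le (delta x y : R) k : 0 < delta -> delta < 1 -> 0 < y ->
  k%:R * m <= (1 - delta) * x ->
  pr P (S k @^-1` [set s | x < s%:R]) <=
    expR (- (delta ^+ 2 / 4 * (x / y))) +
    k%:R * pr P (xi0 @^-1` [set j | y < j%:R]).
Proof.
move=> d0 d1 y0 km.
have m0 := mean_ge0.
pose n := (Num.trunc y).+1.
pose a := delta / 2; pose l := a / y.
have a0 : 0 < a by rewrite /a; lra.
have a1 : 0 < 1 - a by rewrite /a; lra.
have l0 : 0 < l by rewrite divr_gt0.
have -> : [set j : nat | y < j%:R] = [set j | (n <= j)%N].
  apply/seteqP; split => j /=; rewrite /n; last first.
    by rewrite -(ler_nat R); exact: lt_le_trans (truncnS_gt _).
  by rewrite -truncn_lt_nat // ltW.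
have M1 : \sum_(0 <= j < n) p j * expR (l * j%:R) <= expR (l * m / (1 - a)).
  apply: (@le_trans _ _ (\sum_(0 <= j < n)
      (p j + (l / (1 - a)) * (p j * j%:R)))).
    apply: ler_sum_nat => j /andP[_ jn].
    have la : l * j%:R <= a.
      rewrite /l mulrAC ler_pdivrMr // ler_pM2l //.
      by rewrite -truncn_ge_nat // ltW.
    have l0' : 0 <= l * j%:R by rewrite mulr_ge0 // ltW.
    (* For [u <= a], [expR u <= 1 / (1 - u) = 1 + u / (1 - u) <= 1 + u / (1 - a)]. *)
    have e1 : expR (l * j%:R) <= 1 + (l * j%:R) / (1 - a).
      apply: (le_trans (expR_le_div1B _)); first lra.
      set u := l * j%:R in la l0' *.
      have -> : (1 - u)^-1 = 1 + u / (1 - u) by field; lra.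
      rewrite lerD2l ler_wpM2l // lef_pV2 ?posrE; lra.
    have := ler_wpM2l (pr_ge0 P (xi0 @^-1` [set j])) e1.
    move=> /le_trans; apply; rewrite mulrDr mulr1 lerD2l.
    by rewrite le_eqVlt; apply/orP; left; apply/eqP; ring.
  rewrite big_split /= -mulr_sumr; apply: le_trans (expR_ge1Dx _).
  apply: lerD; first exact: sum_pr_le1.
  by rewrite [leRHS]mulrAC ler_wpM2l // ltW // divr_gt0.
apply: (le_trans (chernoff_gt (ltW l0) (expR_ge0 _) M1 k x)).
rewrite lerD2r -expRM_natl -expRD ler_expR.
have : k%:R * (l * m / (1 - a)) <= l * x * (1 - a).
  have -> : k%:R * (l * m / (1 - a)) = (k%:R * m) * (l / (1 - a)) by ring.
  have : (k%:R * m) * (l / (1 - a)) <= ((1 - delta) * x) * (l / (1 - a)).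
    by rewrite ler_wpM2r // ltW // divr_gt0.
  move=> /le_trans; apply.
  have x0 : 0 <= x.
    have h : 0 <= (1 - delta) * x by apply: le_trans km; rewrite mulr_ge0.
    by rewrite -(pmulr_rge0 _ (_ : 0 < 1 - delta)) //; lra.
  rewrite mulrA ler_pdivrMr // [_ * l]mulrC mulrA mulrAC -[leRHS]mulrA.
  rewrite -mulrA [l * x * _]mulrC.
  have : 0 <= l * x by rewrite mulr_ge0 // ltW.
  rewrite /a; nra.
have -> : l * x = delta / 2 * (x / y) by rewrite /l /a; ring.
rewrite /a expr2; lra.
Qed.

(** First-order expansion of the Laplace transform at the origin. Only the values
below some [J], which already carry a mean above [m'], are expanded, so that the
quadratic error is bounded without a second moment. *)
Lemma laplace_le (m' : R) : m' < m -> exists2 l, 0 < l &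
  forall n, \sum_(0 <= j < n) p j * expR (- (l * j%:R)) <= expR (- (l * m')).
Proof.
move=> m'm; have [J HJ] := m_lim m'm.
set s := \sum_(0 <= j < J) _ in HJ.
pose l := (s - m') / (J%:R ^+ 2 + 1).
have J2 : 0 < J%:R ^+ 2 + 1 :> R by rewrite ltr_wpDl // sqr_ge0.
have l0 : 0 < l by rewrite divr_gt0 // subr_gt0.
exists l => // n.
apply: (@le_trans _ _ (1 - l * s + l ^+ 2 * J%:R ^+ 2)); last first.
  apply: le_trans (expR_ge1Dx _).
  have lJ : l * J%:R ^+ 2 <= s - m'.
    by rewrite /l mulrAC ler_pdivrMr // ler_pM2l ?subr_gt0 // lerDl.
  have : l * (l * J%:R ^+ 2) <= l * (s - m') by rewrite ler_pM2l.
  rewrite expr2; lra.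
have q2 (u : R) : 0 <= u -> expR (- u) <= 1 - u + u ^+ 2.
  move=> u0; rewrite expRN -[leRHS]invrK lef_pV2 ?posrE ?expR_gt0 //; last first.
    by rewrite invr_gt0; nra.
  apply: le_trans (expR_ge1Dx _); rewrite -[leLHS]mul1r ler_pdivrMr; last nra.
  by have := exprn_ge0 3 u0; rewrite !exprS expr0; lra.
have key N : (J <= N)%N -> \sum_(0 <= j < N) p j * expR (- (l * j%:R)) <=
    1 - l * s + l ^+ 2 * J%:R ^+ 2.
  move=> JN; rewrite (big_cat_nat (leq0n J) JN) //=.
  have h1 : \sum_(0 <= j < J) p j * expR (- (l * j%:R)) <=
      \sum_(0 <= j < J) (p j + (- l) * (p j * j%:R) + (l ^+ 2 * J%:R ^+ 2) * p j).
    apply: ler_sum_nat => j /andP[_ jJ].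
    have jJ' : j%:R <= J%:R :> R by rewrite ler_nat ltnW.
    have := ler_wpM2l (pr_ge0 P (xi0 @^-1` [set j])) (q2 (l * j%:R) _).
    have -> : 0 <= l * j%:R by rewrite mulr_ge0 // ltW.
    move=> /(_ isT) /le_trans; apply.
    have : p j * (l * j%:R) ^+ 2 <= p j * (l ^+ 2 * J%:R ^+ 2).
      by rewrite ler_wpM2l ?pr_ge0 // exprMn ler_wpM2l ?sqr_ge0 // lerXn2r ?nnegrE.
    lra.
  have h2 : \sum_(J <= j < N) p j * expR (- (l * j%:R)) <= \sum_(J <= j < N) p j.
    apply: ler_sum => j _; rewrite ler_piMr ?pr_ge0 // -expR0 ler_expR oppr_le0.
    by rewrite mulr_ge0 // ltW.
  have h3 : \sum_(0 <= j < J) p j + \sum_(J <= j < N) p j <= 1.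
    by rewrite -(big_cat_nat (leq0n J) JN) //; exact: sum_pr_le1.
  have h4 : l ^+ 2 * J%:R ^+ 2 * \sum_(0 <= j < J) p j <= l ^+ 2 * J%:R ^+ 2.
    rewrite ler_piMr //; last exact: sum_pr_le1.
    by apply: mulr_ge0; exact: sqr_ge0.
  move: h1; rewrite !big_split /= -!mulr_sumr -/s; lra.
have [|nJ] := leqP J n; first exact: key.
apply: le_trans (key J (leqnn J)); rewrite [leRHS](big_cat_nat (leq0n n) (ltnW nJ)) //=.
by rewrite lerDl; apply: sumr_ge0 => j _; rewrite mulr_ge0 ?pr_ge0 ?expR_ge0.
Qed.

Lemma partial_sum_le_le (m' : R) : m' < m -> exists2 l, 0 < l & forall k x,
  pr P (S k @^-1` [set s | s%:R <= x]) <= expR (l * (x - k%:R * m')).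
Proof.
move=> /laplace_le[l l0 H]; exists l => // k x.
apply: (le_trans (chernoff_le (ltW l0) (expR_ge0 _) H k x)).
rewrite -expRM_natl -expRD ler_expR.
by rewrite le_eqVlt; apply/orP; left; apply/eqP; ring.
Qed.

End Chernoff.

(** * Tail of a random sum *)

Section RandomSum.
Context {d : measure_display} {T : measurableType d} {R : realType}.
Variable P : probability T R.

Definition nat_tail (Z : T -> nat) (x : R) : R := pr P (Z @^-1` [set k | x < k%:R]).

Lemma nat_tail_nonincreasing Z : nat_measurable Z ->
  {homo nat_tail Z : x y /~ x <= y}.
Proof.
by move=> mZ x y xy; apply: le_pr => // w /=; exact: le_lt_trans.
Qed.

Definition truncated_mean (Z : T -> nat) (x : R) : R :=
  \sum_(0 <= k < (Num.trunc x).+1) pr P (Z @^-1` [set k]) * k%:R.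

Lemma truncated_mean_le Z x : nat_measurable Z -> 1 <= x -> truncated_mean Z x <= x.
Proof.
move=> mZ x1; have x0 : 0 <= x by lra.
apply: (@le_trans _ _ (\sum_(0 <= k < (Num.trunc x).+1) x * pr P (Z @^-1` [set k]))).
  apply: ler_sum_nat => k /andP[_ kx].
  by rewrite mulrC ler_wpM2r ?pr_ge0 // -truncn_ge_nat.
by rewrite -mulr_sumr ler_piMr //; exact: sum_pr_le1.
Qed.

(** The recursion required by [regvar_dominates]. *)
Lemma truncated_mean_half Z x : nat_measurable Z -> 1 <= x ->
  truncated_mean Z x <= truncated_mean Z (x / 2) + x * nat_tail Z (x / 2).
Proof.
move=> mZ x1; have x0 : 0 <= x by lra.
have le : ((Num.trunc (x / 2)).+1 <= (Num.trunc x).+1)%N.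
  by rewrite ltnS; apply: le_truncn; lra.
rewrite {1}/truncated_mean (big_cat_nat (leq0n _) le) //= lerD2l.
apply: (@le_trans _ _ (\sum_((Num.trunc (x / 2)).+1 <= k < (Num.trunc x).+1)
    x * pr P (Z @^-1` [set k]))).
  apply: ler_sum_nat => k /andP[_ kx].
  by rewrite mulrC ler_wpM2r ?pr_ge0 // -truncn_ge_nat.
rewrite -mulr_sumr ler_wpM2l //; apply: (le_trans (sum_pr_le P _ _ mZ)).
apply: le_pr => // w /=; rewrite -(ler_nat R).
exact: lt_le_trans (truncnS_gt _).
Qed.

Variables (N : T -> nat) (xi : nat -> T -> nat) (xi0 : T -> nat).
Local Notation S := (partial_sum xi).

Hypothesis mN : nat_measurable N.
Hypothesis mxi0 : nat_measurable xi0.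
Hypothesis mxi : forall k, nat_measurable (xi k).
Hypothesis mS : forall k, nat_measurable (S k).
Hypothesis mSN : nat_measurable (fun w => S (N w) w).
Hypothesis xi_law : forall k A, pr P (xi k @^-1` A) = pr P (xi0 @^-1` A).
Hypothesis S_indep : forall k A B,
  pr P (S k @^-1` A `&` xi k @^-1` B) =
  pr P (S k @^-1` A) * pr P (xi k @^-1` B).
Hypothesis N_indep : forall k A B,
  pr P (N @^-1` A `&` S k @^-1` B) = pr P (N @^-1` A) * pr P (S k @^-1` B).

Variable m : R.
Hypothesis m_gt0 : 0 < m.
Hypothesis m_ge : forall n,
  \sum_(0 <= j < n) pr P (xi0 @^-1` [set j]) * j%:R <= m.
Hypothesis m_lim : forall m', m' < m ->
  exists n, m' < \sum_(0 <= j < n) pr P (xi0 @^-1` [set j]) * j%:R.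

Variables (gamma r K : R).
Hypothesis gamma_ge0 : 0 <= gamma.
Hypothesis r_gt : Num.max 1 gamma < r.
Hypothesis xi_tail : forall y, 0 < y -> nat_tail xi0 y <= K * y `^ (- r).
Hypothesis N_regvar : regvar (nat_tail N) gamma.

Local Notation F := (nat_tail N).
Local Notation G := (nat_tail (fun w => S (N w) w)).

(** Either [N] is large by itself, or a moderate number of summands produces a
large sum. *)
Lemma random_sum_cover c x : 0 < c -> 0 < x ->
  G x <= F (c * x) + \sum_(0 <= k < (Num.trunc (c * x)).+1)
    pr P (N @^-1` [set k]) * nat_tail (S k) x.
Proof.
move=> c0 x0; pose C k := N @^-1` [set k] `&` S k @^-1` [set s | x < s%:R].
rewrite [X in _ + X](eq_bigr (fun k => pr P (C k))); last first.
  by move=> k _; rewrite /C N_indep.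
apply: pr_le_cover => //.
  by move=> k; apply: measurableI; [exact: mN|exact: mS].
move=> w /= H; have [Nw|Nw] := ltP (c * x) (N w)%:R; first by left.
right; exists (N w) => //.
by rewrite -(ltr_nat R); apply: le_lt_trans (truncnS_gt _).
Qed.

(** The second alternative of [random_sum_cover] does not contribute. With the
truncation level [x `^ theta] for some [theta < 1], [partial_sum_gt_le] bounds its
probability by a stretched exponential plus
[truncated_mean N (c * x) * nat_tail xi0 (x `^ theta)]. The last factor is of
order [x `^ (- rho)] with [rho = theta * r], while the truncated mean is of order
[x `^ s * F x]; it remains to choose [Num.max 1 gamma < s < rho < r]. *)
Lemma big_jump_negligible delta e : 0 < delta -> delta < 1 -> 0 < e ->
  \forall x \near +oo,
    \sum_(0 <= k < (Num.trunc ((1 - delta) / m * x)).+1)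
      pr P (N @^-1` [set k]) * nat_tail (S k) x <= e * F x.
Proof.
move=> d0 d1 e0; set c := (1 - delta) / m.
have c0 : 0 < c by rewrite divr_gt0 //; lra.
have [F0 rvF] := N_regvar.
move: r_gt; rewrite gt_max => /andP[r1 rg].
pose M := Num.max 1 gamma.
have M1 : 1 <= M by rewrite le_max lexx.
have Mg : gamma <= M by rewrite le_max lexx orbT.
have Mr : M < r by [].
pose s := (2 * M + r) / 3; pose rho := (M + 2 * r) / 3.
have sM : M < s by rewrite /s; lra.
have srho : s < rho by rewrite /s /rho; lra.
have rhor : rho < r by rewrite /rho; lra.
have r0 : 0 < r by lra.
pose theta := rho / r.
have th1 : theta < 1 by rewrite /theta ltr_pdivrMr // mul1r.
have s1 : 1 < s by lra.
have gs : gamma < s by lra.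
have Fdec := nat_tail_nonincreasing mN.
have [C1 C1_0 H1] := regvar_dominates N_regvar Fdec gamma_ge0 gs s1
  (fun x => truncated_mean_le mN) (fun x => truncated_mean_half mN).
(* A power lower bound on [F], to compare it with the stretched exponential. *)
have [C2 C2_0 H2] : exists2 C, 0 < C & \forall x \near +oo, 1 <= C * (x `^ s * F x).
  apply: (regvar_dominates (W := fun=> 1) N_regvar) => // x x1.
  by rewrite lerDl mulr_ge0 ?pr_ge0 //; lra.
have [H3 _] := (regvarP gamma F0).1 N_regvar c c0.
have K0 : 0 <= K.
  have := xi_tail ltr01; rewrite powR1 mulr1; apply: le_trans; exact: pr_ge0.
pose D := K * (C1 * (c `^ s * (2 * c `^ (- gamma)))) + 1.
have D0 : 0 < D.
  by rewrite ltr_wpDl // !mulr_ge0 ?powR_ge0 // ltW.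
near=> x.
have x0 : 0 < x by near: x; apply: nbhs_pinfty_gt; exact: num_real.
have h1 : truncated_mean N (c * x) <= C1 * ((c * x) `^ s * F (c * x)).
  near: x; exact: (near_pinfty_scale c0 H1).
have h2 : 1 <= C2 * (x `^ s * F x) by near: x.
have h3 : F (c * x) <= (1 + 1) * (c `^ (- gamma) * F x) by near: x; exact: H3.
have h4 : x `^ (s - rho) <= e / 2 / D.
  by near: x; apply: near_powR_le; [rewrite subr_lt0|rewrite !divr_gt0].
have h5 : expR (- (delta ^+ 2 / 4 * x `^ (1 - theta))) * x `^ s <= e / 2 / C2.
  near: x; apply: near_expR_powR_le; rewrite ?divr_gt0 ?exprn_gt0 ?subr_gt0 //.
set E := expR _ in h5.
pose y := x `^ theta.
have y0 : 0 < y by rewrite powR_gt0.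
have xy : x / y = x `^ (1 - theta).
  by rewrite powRB ?(gt_eqF x0) ?implybT // powRr1 // ltW.
have tau : nat_tail xi0 y <= K * x `^ (- rho).
  by have := xi_tail y0; rewrite /y -powRrM mulrN /theta divfK // gt_eqF.
apply: (@le_trans _ _ (E + nat_tail xi0 y * truncated_mean N (c * x))).
  rewrite /truncated_mean mulr_sumr.
  apply: (@le_trans _ _ (\sum_(0 <= k < (Num.trunc (c * x)).+1)
     (E * pr P (N @^-1` [set k]) + nat_tail xi0 y * (pr P (N @^-1` [set k]) * k%:R)))).
    apply: ler_sum_nat => k /andP[_ kx].
    have km : k%:R * m <= (1 - delta) * x.
      rewrite -ler_pdivlMr // mulrAC -truncn_ge_nat //.
      by rewrite mulr_ge0 // ltW.
    have := partial_sum_gt_le mxi0 mxi mS xi_law S_indep m_ge d0 d1 y0 km.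
    rewrite xy -/E => H.
    apply: (le_trans (ler_wpM2l (pr_ge0 _ _) H)); rewrite mulrDr.
    by rewrite le_eqVlt; apply/orP; left; apply/eqP; rewrite /nat_tail; ring.
  rewrite big_split /= lerD2r -mulr_sumr ler_piMr ?expR_ge0 //.
  exact: sum_pr_le1.
have hE : E <= e / 2 * F x.
  have Fx := F0 x.
  have : E * 1 <= E * (C2 * (x `^ s * F x)) by rewrite ler_wpM2l // expR_ge0.
  rewrite mulr1 => /le_trans; apply.
  have -> : E * (C2 * (x `^ s * F x)) = (E * x `^ s) * (C2 * F x) by ring.
  apply: (le_trans (ler_wpM2r _ h5)); first by rewrite mulr_ge0 // ltW.
  by rewrite mulrA divfK // gt_eqF.
have hW : nat_tail xi0 y * truncated_mean N (c * x) <= e / 2 * F x.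
  have Fx := F0 x.
  have W0 : 0 <= truncated_mean N (c * x).
    by apply: sumr_ge0 => k _; rewrite mulr_ge0 ?pr_ge0.
  apply: (le_trans (ler_wpM2r W0 tau)).
  have Kx : 0 <= K * x `^ (- rho) by rewrite mulr_ge0 // powR_ge0.
  apply: (le_trans (ler_wpM2l Kx h1)).
  apply: (@le_trans _ _ (K * x `^ (- rho) *
      (C1 * ((c * x) `^ s * ((1 + 1) * (c `^ (- gamma) * F x)))))).
    rewrite ler_wpM2l // ler_wpM2l ?(ltW C1_0) //.
    by rewrite ler_wpM2l // powR_ge0.
  rewrite powRM ?(ltW c0) ?(ltW x0) //.
  have -> : K * x `^ (- rho) * (C1 * (c `^ s * x `^ s * ((1 + 1) * (c `^ (- gamma) * F x))))
     = (D - 1) * (x `^ s * x `^ (- rho)) * F x by rewrite /D; ring.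
  rewrite -powRD ?(gt_eqF x0) ?implybT // ler_wpM2r ?(ltW Fx) //.
  apply: (@le_trans _ _ (D * x `^ (s - rho))).
    by rewrite ler_wpM2r ?powR_ge0 //; lra.
  by rewrite mulrC -ler_pdivlMr.
lra.
Unshelve. all: by end_near. Qed.

(** [S N > x] forces [N > x / (u * m)] up to a negligible event, for every [u > 1]. *)
Lemma random_sum_asymp_le : asymp_le G (fun x => m `^ gamma * F x).
Proof.
have [F0 rvF] := N_regvar.
have mg : 0 < m `^ gamma by exact: powR_gt0.
apply: asymp_le_approx => // [x|e e0]; first exact: ltW.
have e2 : 0 < e / 2 by lra.
have [u u1 ug] := exists_powR_le gamma_ge0 e2.
have u0 : 0 < u by lra.
pose delta := 1 - u^-1.
have d0 : 0 < delta by rewrite subr_gt0 invf_lt1.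
have d1 : delta < 1 by rewrite /delta ltrBlDr ltrDl invr_gt0.
have ed : 1 - delta = u^-1 by rewrite /delta; ring.
have c0 : 0 < (1 - delta) / m by rewrite ed mulr_gt0 // invr_gt0.
have [H1 _] := (regvarP gamma F0).1 N_regvar _ c0.
have ec : ((1 - delta) / m) `^ (- gamma) = u `^ gamma * m `^ gamma.
  rewrite ed -invfM invr_powR ?opprK; last by rewrite mulr_ge0 // ltW.
  by rewrite powRM //; exact: ltW.
exists (u `^ gamma * m `^ gamma + e / 2 * m `^ gamma).
  have : u `^ gamma * m `^ gamma <= (1 + e / 2) * m `^ gamma.
    by rewrite ler_pM2r.
  lra.
rewrite -ec; apply: (asymp_le_trans
  (g := fun x => F ((1 - delta) / m * x) + e / 2 * m `^ gamma * F x)).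
- move=> x; rewrite mulr_ge0 // ?(ltW (F0 x)) // addr_ge0 ?powR_ge0 //.
  by rewrite mulr_ge0 // ltW.
- apply: asymp_le_near => [x|].
    by rewrite addr_ge0 ?(ltW (F0 _)) // !mulr_ge0 ?(ltW (F0 _)) // ltW.
  near=> x.
  have x0 : 0 < x by near: x; apply: nbhs_pinfty_gt; exact: num_real.
  apply: (le_trans (random_sum_cover c0 x0)); rewrite lerD2l.
  by near: x; apply: big_jump_negligible => //; exact: mulr_gt0.
- have -> : (fun x => (((1 - delta) / m) `^ (- gamma) + e / 2 * m `^ gamma) * F x)
     = (fun x => ((1 - delta) / m) `^ (- gamma) * F x + e / 2 * m `^ gamma * F x).
    by apply/funext => x; rewrite mulrDl.
  apply: asymp_leD => //; apply: asymp_le_near; last by near=> x.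
  by move=> x; rewrite !mulr_ge0 ?(ltW (F0 _)) // ltW.
Unshelve. all: by end_near. Qed.

(** If [N > u * x / m] with [u > 1], the first [u * x / m] summands already exceed
[x] with probability tending to one, and they are independent of [N]. *)
Lemma random_sum_asymp_ge : asymp_le (fun x => m `^ gamma * F x) G.
Proof.
have [F0 rvF] := N_regvar.
move=> e e0.
pose a := Num.min 1 (e / 7).
have a0 : 0 < a by rewrite lt_min ltr01 divr_gt0.
have a1 : a <= 1 by rewrite ge_min lexx.
(* Three factors [1 + a] are lost below, and [(1 + a) ^ 3 <= 1 + 7 * a]. *)
have ae : a <= e / 7 by rewrite ge_min lexx orbT.
have [u u1 ug] := exists_powR_le gamma_ge0 a0.
have u0 : 0 < u by lra.
pose c := u / m.
have c0 : 0 < c by rewrite divr_gt0.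
have [_ H1] := (regvarP gamma F0).1 N_regvar _ c0.
(* Any [v] strictly between [1] and [u] works: the mean is lowered to [m / v], and
[u / v > 1] leaves a linear exponent. *)
pose v := (1 + u) / 2.
have v1 : 1 < v by rewrite /v; lra.
have vu : v < u by rewrite /v; lra.
have v0 : 0 < v by lra.
have mv : m / v < m by rewrite ltr_pdivrMr // ltr_pMr.
have [l l0 H2] := partial_sum_le_le mxi0 mxi mS xi_law S_indep m_lim mv.
pose b := l * (u / v - 1).
have b0 : 0 < b by rewrite mulr_gt0 // subr_gt0 ltr_pdivlMr // mul1r.
near=> x.
have x0 : 0 < x by near: x; apply: nbhs_pinfty_gt; exact: num_real.
have h1 : c `^ (- gamma) * F x <= (1 + a) * F (c * x) by near: x; exact: H1.
have h2 : expR (- (b * x `^ 1)) * x `^ 0 <= a / (1 + a).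
  near: x; apply: near_expR_powR_le => //.
  by rewrite divr_gt0 //; lra.
pose k := (Num.trunc (c * x)).+1.
have kc : c * x < k%:R by exact: truncnS_gt.
have h3 : nat_tail (S k) x >= 1 - a / (1 + a).
  have -> : nat_tail (S k) x = 1 - pr P (S k @^-1` [set s | s%:R <= x]).
    rewrite -prC; last exact: mS.
    congr pr; apply/seteqP; split=> w /=; first by rewrite ltNge => /negP.
    by move=> /negP; rewrite ltNge.
  rewrite lerD2l lerN2; apply: le_trans h2; rewrite powRr0 mulr1 powRr1 ?(ltW x0) //.
  apply: (le_trans (H2 _ _)); rewrite ler_expR /b.
  have -> : - (l * (u / v - 1) * x) = l * - ((u / v - 1) * x) by ring.
  rewrite ler_pM2l //.
  have : c * x * (m / v) <= k%:R * (m / v).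
    by rewrite ler_wpM2r // ltW // divr_gt0.
  have -> : c * x * (m / v) = u / v * x.
    by rewrite /c; field; rewrite !gt_eqF.
  lra.
have h4 : F (c * x) * nat_tail (S k) x <= G x.
  rewrite /nat_tail -N_indep; apply: le_pr => //.
    by apply: measurableI; [exact: mN|exact: mS].
  move=> w [/= Nw Sw]; apply: lt_le_trans Sw _; rewrite ler_nat /partial_sum.
  have kN : (k <= N w)%N.
    by rewrite /k truncn_lt_nat // mulr_ge0 // ltW.
  rewrite -!(big_mkord xpredT (fun i => xi i w)) (big_cat_nat (leq0n k) kN) //=.
  exact: leq_addr.
have Fc := F0 (c * x).
have h5 : F (c * x) <= (1 + a) * G x.
  have : F (c * x) * (1 - a / (1 + a)) <= G x.
    by apply: le_trans h4; rewrite ler_pM2l.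
  have -> : 1 - a / (1 + a) = (1 + a)^-1 by field; lra.
  by rewrite ler_pdivrMr 1?mulrC //; lra.
have h6 : m `^ gamma * F x <= (1 + a) * (c `^ (- gamma) * F x).
  have mu0 : 0 < m / u by exact: divr_gt0.
  have -> : c = (m / u)^-1 by rewrite invf_div.
  rewrite invr_powR ?opprK ?(ltW mu0) // mulrA ler_wpM2r ?(ltW (F0 x)) //.
  have -> : m `^ gamma = (m / u) `^ gamma * u `^ gamma.
    by rewrite -powRM ?(ltW mu0) ?(ltW u0) // divfK // lt0r_neq0.
  by rewrite [leLHS]mulrC ler_wpM2r ?powR_ge0.
have Gx : 0 <= G x by exact: pr_ge0.
apply: (le_trans h6).
have h7 : (1 + a) * (c `^ (- gamma) * F x) <= (1 + a) * ((1 + a) * F (c * x)).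
  by rewrite ler_pM2l //; lra.
apply: (le_trans h7).
have h8 : (1 + a) * ((1 + a) * F (c * x)) <= (1 + a) * ((1 + a) * ((1 + a) * G x)).
  by rewrite !ler_pM2l //; lra.
apply: (le_trans h8); rewrite !mulrA ler_wpM2r //.
have : a * a <= a by rewrite ler_piMl // ltW.
have : a * a * a <= a by rewrite ler_piMl ?(ltW a0) //; nra.
lra.
Unshelve. all: by end_near. Qed.

End RandomSum.

(** * Tail of an independent sum *)

Section IndependentSum.
Context {d : measure_display} {T : measurableType d} {R : realType}.
Variable P : probability T R.
Variables (U V : T -> nat) (gamma : R).
Hypothesis mU : nat_measurable U.
Hypothesis mV : nat_measurable V.
Hypothesis UV_indep : forall A B,
  pr P (U @^-1` A `&` V @^-1` B) = pr P (U @^-1` A) * pr P (V @^-1` B).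
Hypothesis gamma_ge0 : 0 <= gamma.
Hypothesis U_regvar : regvar (nat_tail P U) gamma.
Hypothesis V_regvar : regvar (nat_tail P V) gamma.
Hypothesis V_tail0 : forall e, 0 < e -> \forall x \near +oo, nat_tail P V x <= e.

Local Notation UV := (fun w => (U w + V w)%N).

Lemma nat_measurable_add : nat_measurable UV.
Proof.
move=> A; rewrite (preimage_comp2 U V addn); apply: bigcupT_measurable => t.
by apply: measurableI; [exact: mU|exact: mV].
Qed.

(** [U + V > x] holds as soon as one of the two exceeds [x], and both do so with
probability [o(1)] times that of [U > x]. *)
Lemma indep_sum_asymp_ge :
  asymp_le (fun x => nat_tail P U x + nat_tail P V x) (nat_tail P UV).
Proof.
have [U0 _] := U_regvar; have [V0 _] := V_regvar.
move=> e e0; near=> x.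
have h : nat_tail P V x <= e / (1 + e) by near: x; apply: V_tail0; rewrite divr_gt0 //; lra.
have h2 : nat_tail P V x + nat_tail P U x * (1 - nat_tail P V x) <= nat_tail P UV x.
  have -> : 1 - nat_tail P V x = pr P (V @^-1` (~` [set k | x < k%:R])).
    by rewrite -preimage_setC prC //; exact: mV.
  rewrite [in X in _ + X]/nat_tail -UV_indep -prU; first last.
  - by apply/seteqP; split => // w [/= ? []].
  - by apply: measurableI; [exact: mU|exact: mV].
  - exact: mV.
  apply: le_pr.
  - apply: measurableU; first exact: mV.
    by apply: measurableI; [exact: mU|exact: mV].
  - exact: nat_measurable_add.
  - move=> w /=; rewrite natrD => -[|[+ _]].
      by move=> h'; apply: (lt_le_trans h'); rewrite lerDr.
    by move=> h'; apply: (lt_le_trans h'); rewrite lerDl.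
have e1 : (1 + e)^-1 = 1 - e / (1 + e) by field; lra.
have e2 : 0 < (1 + e)^-1 by rewrite invr_gt0; lra.
have e3 : (1 + e)^-1 <= 1 by rewrite invf_le1; lra.
have Ux := U0 x; have Vx := V0 x.
have : (1 + e)^-1 * (nat_tail P U x + nat_tail P V x) <= nat_tail P UV x.
  apply: le_trans h2; rewrite mulrDr addrC lerD //; first by rewrite ler_piMl // ltW.
  by rewrite mulrC ler_pM2l //; lra.
by rewrite mulrC ler_pdivrMr 1?mulrC //; lra.
Unshelve. all: by end_near. Qed.

(** If [U + V > x], one of the variables exceeds [q * x], or both exceed
[(1 - q) * x]; by independence the last event has probability [o(1)] times
the tail of [U], for every fixed [q < 1]. *)
Lemma indep_sum_asymp_le :
  asymp_le (nat_tail P UV) (fun x => nat_tail P U x + nat_tail P V x).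
Proof.
have [U0 _] := U_regvar; have [V0 _] := V_regvar.
have W0 x : 0 <= nat_tail P U x + nat_tail P V x by rewrite addr_ge0 // ltW.
have -> : (fun x => nat_tail P U x + nat_tail P V x) =
    (fun x => 1 * (nat_tail P U x + nat_tail P V x)).
  by apply/funext => x; rewrite mul1r.
apply: asymp_le_approx => // e e0.
have e2 : 0 < e / 2 by lra.
have [u u1 ug] := exists_powR_le gamma_ge0 e2.
have u0 : 0 < u by lra.
pose q := u^-1; pose q' := 1 - q.
have q0 : 0 < q by rewrite invr_gt0.
have q'0 : 0 < q' by rewrite subr_gt0 invf_lt1.
have qg : q `^ (- gamma) = u `^ gamma by rewrite invr_powR ?opprK // ltW.
have [HU _] := (regvarP gamma U0).1 U_regvar _ q0.
have [HV _] := (regvarP gamma V0).1 V_regvar _ q0.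
have [HU' _] := (regvarP gamma U0).1 U_regvar _ q'0.
rewrite qg in HU HV.
exists (u `^ gamma + e / 2); first lra.
have c0 : 0 < e / 2 / ((1 + 1) * q' `^ (- gamma)).
  by rewrite divr_gt0 // mulr_gt0 // powR_gt0.
pose big x := nat_tail P U (q' * x) * nat_tail P V (q' * x).
apply: (asymp_le_trans (g := fun x =>
  (nat_tail P U (q * x) + nat_tail P V (q * x)) +
   e / 2 * (nat_tail P U x + nat_tail P V x))).
- by move=> x; rewrite mulr_ge0 // addr_ge0 ?powR_ge0 // ltW.
- apply: asymp_le_near => [x|].
    by rewrite addr_ge0 // mulr_ge0 // ltW.
  near=> x.
  have x0 : 0 < x by near: x; apply: nbhs_pinfty_gt; exact: num_real.
  have cover : nat_tail P UV x <=
      (nat_tail P U (q * x) + nat_tail P V (q * x)) + big x.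
    rewrite /big [nat_tail P U (q' * x)]/nat_tail [nat_tail P V (q' * x)]/nat_tail -UV_indep.
    set A1 := U @^-1` [set k | q * x < k%:R].
    set A2 := V @^-1` [set k | q * x < k%:R].
    set A3 := _ `&` _.
    have m1 : measurable A1 by exact: mU.
    have m2 : measurable A2 by exact: mV.
    have m3 : measurable A3 by apply: measurableI; [exact: mU|exact: mV].
    apply: (@le_trans _ _ (pr P (A1 `|` A2 `|` A3))).
      apply: le_pr; first exact: nat_measurable_add.
        by apply: measurableU => //; exact: measurableU.
      move=> w; rewrite /A1 /A2 /A3 /= natrD => H.
      have [|Uw] := ltP (q * x) (U w)%:R; first by left; left.
      have [|Vw] := ltP (q * x) (V w)%:R; first by left; right.
      by right; rewrite /q' mulrBl mul1r; split; lra.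
    apply: (le_trans (pr_leU _ _ _)) => //; first exact: measurableU.
    by rewrite lerD2r; exact: pr_leU.
  apply: (le_trans cover); rewrite lerD2l /big.
  have h1 : nat_tail P V (q' * x) <= e / 2 / ((1 + 1) * q' `^ (- gamma)).
    by near: x; apply: (near_pinfty_scale q'0 (V_tail0 c0)).
  have h2 : nat_tail P U (q' * x) <= (1 + 1) * (q' `^ (- gamma) * nat_tail P U x).
    by near: x; exact: HU'.
  apply: (le_trans (ler_pM (ltW (U0 _)) (ltW (V0 _)) h2 h1)).
  have -> : (1 + 1) * (q' `^ (- gamma) * nat_tail P U x) *
     (e / 2 / ((1 + 1) * q' `^ (- gamma))) = e / 2 * nat_tail P U x.
    by field; rewrite gt_eqF // powR_gt0.
  by rewrite ler_pM2l // lerDl ltW.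
- have -> : (fun x => (u `^ gamma + e / 2) * (nat_tail P U x + nat_tail P V x)) =
    (fun x => (u `^ gamma * nat_tail P U x + u `^ gamma * nat_tail P V x) +
       e / 2 * (nat_tail P U x + nat_tail P V x)).
    by apply/funext => x; rewrite mulrDl mulrDr.
  apply: asymp_leD; first exact: asymp_leD.
  by apply: asymp_le_near => [x|]; [rewrite mulr_ge0 // ltW|near=> x].
Unshelve. all: by end_near. Qed.

End IndependentSum.

(** * Moments of natural-number-valued variables *)

Section Moments.
Context {d : measure_display} {T : measurableType d} {R : realType}.
Variables (P : probability T R) (Z : {RV P >-> nat}).

(** The only place where the Lebesgue integral is opened: afterwards moments are
series against the mass function. *)
Lemma expectation_nat (g : nat -> R) : (forall k, 0 <= g k) ->
  ('E_P[fun w => g (Z w)] =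
   \sum_(0 <= k <oo) (pr P (Z @^-1` [set k]) * g k)%:E)%E.
Proof.
move=> g0; rewrite unlock.
have cov : [set: T] = \bigcup_k (Z @^-1` [set k]).
  by apply/seteqP; split=> // w _; exists (Z w).
have mg : measurable_fun setT (fun w => g (Z w)).
  exact: (@measurableT_comp _ _ _ _ _ _ g _ Z).
rewrite cov ge0_integral_bigcup.
- apply: eq_eseriesr => k _.
  rewrite (eq_integral (fun=> (g k)%:E)); last first.
    by move=> w; rewrite inE /= => ->.
  rewrite integral_cst; last exact: measurable_preimage_nat.
  rewrite EFinM muleC; congr (_ * _)%E.
  by apply: prE; exact: measurable_preimage_nat.
- by move=> k; exact: measurable_preimage_nat.
- by rewrite -cov; exact/measurable_EFinP.
- by move=> w _; rewrite lee_fin.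
- by move=> i j _ _ [w [/= <- <-]].
Qed.

Hypothesis finite_mean : ('E_P[natRV P Z] < +oo)%E.
Local Notation m := (fine 'E_P[natRV P Z]).
Local Notation p k := (pr P (Z @^-1` [set k])).

Lemma mean_natE : m%:E = (\sum_(0 <= k <oo) (p k * k%:R)%:E)%E.
Proof.
rewrite fineK; first exact: (@expectation_nat (fun k => k%:R)).
rewrite ge0_fin_numE //; apply: expectation_ge0 => w.
by rewrite /natRV ler0n.
Qed.

Lemma partial_mean_le n : \sum_(0 <= k < n) p k * k%:R <= m.
Proof.
rewrite -lee_fin mean_natE -sumEFin.
by apply: nneseries_lim_ge => k _ _; rewrite lee_fin mulr_ge0 ?pr_ge0.
Qed.

Lemma partial_mean_gt m' : m' < m -> exists n, m' < \sum_(0 <= k < n) p k * k%:R.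
Proof.
move=> m'm; apply: contrapT => H.
suff : m <= m' by rewrite leNgt m'm.
rewrite -lee_fin mean_natE; apply: lime_le.
  by apply: is_cvg_nneseries => k _ _; rewrite lee_fin mulr_ge0 ?pr_ge0.
near=> n; rewrite sumEFin lee_fin leNgt; apply/negP => Hn.
by apply: H; exists n.
Unshelve. all: by end_near. Qed.

Lemma markov_nat (f : R -> R) (y : R) : 0 < y -> measurable_fun setT f ->
  (forall t, 0 <= t -> 0 <= f t) -> {in Num.nneg &, {homo f : x y / x <= y}} ->
  ((f y * pr P (Z @^-1` [set k | y <= k%:R]))%:E <= 'E_P[fun w => f (Z w)%:R])%E.
Proof.
move=> y0 mf f0 fincr.
have -> : (fun w => f (Z w)%:R) = (f \o [eta Num.norm]) \o natRV P Z.
  by apply/funext => w /=; rewrite /natRV ger0_norm.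
apply: le_trans (markov (natRV P Z) y0 mf f0 fincr).
have -> : [set w | (y%:E <= `|(natRV P Z w)%:E|)%E] = Z @^-1` [set k | y <= k%:R].
  by apply/seteqP; split=> w /=; rewrite /natRV lee_fin ger0_norm.
by rewrite EFinM -prE //; exact: measurable_preimage_nat.
Qed.

Lemma mean_gt0 : (P (Z @^-1` [set 0%N]) < 1)%E -> 0 < m.
Proof.
move=> Z0.
have mz k : measurable (Z @^-1` k) by exact: measurable_preimage_nat.
have H : pr P (Z @^-1` (~` [set 0%N])) <= m.
  have := @markov_nat id 1 ltr01 (@measurable_id _ _ _) (fun _ h => h)
    (fun _ _ _ _ h => h).
  rewrite mul1r -[X in (_ <= X)%E](@fineK _ 'E_P[natRV P Z]%E); last first.
    rewrite ge0_fin_numE //; apply: expectation_ge0 => w.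
    by rewrite /natRV ler0n.
  rewrite lee_fin; apply: le_trans; apply: le_pr => // w /=.
  by rewrite ler1n lt0n => /eqP.
apply: lt_le_trans H; rewrite -preimage_setC prC // subr_gt0.
by rewrite -lte_fin -prE.
Qed.

End Moments.

Section MomentTail.
Context {d : measure_display} {T : measurableType d} {R : realType}.
Variables (P : probability T R) (Z : {RV P >-> nat}) (r : R).
Hypothesis finite_moment : ('E_P[fun w => ((Z w)%:R `^ r)%R] < +oo)%E.

Lemma moment_tail : 0 < r ->
  exists K, forall y : R, 0 < y -> nat_tail P Z y <= K * y `^ (- r).
Proof.
move=> r0; exists (fine 'E_P[fun w => ((Z w)%:R `^ r)%R]) => y y0.
have mz k : measurable (Z @^-1` k) by exact: measurable_preimage_nat.
rewrite powRN ler_pdivlMr ?powR_gt0 // -lee_fin fineK; last first.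
  by rewrite ge0_fin_numE //; apply: expectation_ge0 => w; exact: powR_ge0.
apply: le_trans (@markov_nat _ _ _ P Z (fun t => t `^ r) y y0 _ _ _).
- rewrite lee_fin mulrC ler_wpM2l ?powR_ge0 //; apply: le_pr => // w /=.
  exact: ltW.
- exact: measurable_powR.
- by move=> t _; exact: powR_ge0.
- by move=> s t s0 t0; apply: ge0_ler_powR => //; exact: ltW.
Qed.

Lemma moment_finite_mean : 1 <= r -> ('E_P[natRV P Z] < +oo)%E.
Proof.
move=> r1; apply: le_lt_trans finite_moment.
rewrite (expectation_nat Z (fun k => ler0n R k)).
rewrite (expectation_nat Z (fun k => powR_ge0 k%:R r)).
apply: lee_nneseries => k _; first by rewrite lee_fin mulr_ge0 ?pr_ge0.
rewrite lee_fin ler_wpM2l ?pr_ge0 //; case: k => [|k]; first exact: powR_ge0.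
by apply: le1r_powR => //; rewrite ler1n.
Qed.

End MomentTail.

(** * Recursion over the generations *)

Section NatTail.
Context {d : measure_display} {T : measurableType d} {R : realType}.
Variables (P : probability T R).

Lemma tail_natRV (Z : {RV P >-> nat}) : tail P (natRV P Z) = nat_tail P Z.
Proof.
apply/funext => x; rewrite /tail /ccdf /distribution /nat_tail /pr /pushforward.
by congr (fine (P _)); apply/seteqP; split=> w; rewrite /= in_itv /= andbT.
Qed.

Lemma near_nat_tail_le (Z : {RV P >-> nat}) (e : R) : 0 < e ->
  \forall x \near +oo, nat_tail P Z x <= e.
Proof.
move=> e0.
have H : (fine \o ccdf (P := P) (natRV P Z)) x @[x --> +oo] --> (0 : R).
  by apply: fine_cvg; exact: cvg_ccdfy0.
move/cvgrPdist_le : H => /(_ e e0).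
apply: filterS => x; rewrite sub0r normrN => /(le_trans (ler_norm _)).
by rewrite -tail_natRV.
Qed.

Lemma regularly_varying_natP (Z : {RV P >-> nat}) gamma :
  regularly_varying P (natRV P Z) gamma <-> regvar (nat_tail P Z) gamma.
Proof.
rewrite /regularly_varying tail_natRV; split.
  move=> [_ pos lim]; split=> // x.
  apply: (@lt_le_trans _ _ (nat_tail P Z (Num.max 1 x))).
    by apply: pos; rewrite lt_max ltr01.
  apply: nat_tail_nonincreasing; first exact: measurable_preimage_nat.
  by rewrite le_max lexx orbT.
by move=> [pos lim]; split=> // w; rewrite /natRV ler0n.
Qed.

Lemma nat_tail_law (Z Z' : {RV P >-> nat}) : identically_distributed P Z Z' ->
  nat_tail P Z = nat_tail P Z'.
Proof.
move=> law; apply/funext => x; rewrite /nat_tail /pr.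
by have := law [set k | x < k%:R] I; rewrite /distribution /pushforward => ->.
Qed.

End NatTail.


Section OneStep.
Context {d : measure_display} {T : measurableType d} {R : realType}.
Variables (P : probability T R) (X : nat -> {RV P >-> nat}).
Variables (xi : nat -> nat -> {RV P >-> nat}) (eps : nat -> {RV P >-> nat}).
Variable gamma : R.
Hypothesis hX : galton_watson_immigration P X xi eps.
Hypothesis hgamma : 0 <= gamma.
Hypothesis heps : regvar (nat_tail P (eps 0%N)) gamma.
Hypothesis hxi0 : (P [set w : T | xi 0%N 0%N w = 0%N] < 1)%E.
Hypothesis hxi : exists2 r : R, Num.max 1 gamma < r
       & ('E_P[fun w => ((xi 0%N 0%N w)%:R `^ r)%R] < +oo)%E.

Local Notation m := (fine 'E_P[natRV P (xi 0%N 0%N)]).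

Lemma offspring_finite_mean : ('E_P[natRV P (xi 0%N 0%N)] < +oo)%E.
Proof.
have [r] := hxi; rewrite gt_max => /andP[r1 _] hr.
exact: moment_finite_mean hr (ltW r1).
Qed.

Lemma offspring_mean_gt0 : 0 < m.
Proof. exact: (mean_gt0 offspring_finite_mean hxi0). Qed.

(** One generation: the random sum over the current individuals has tail
[m `^ gamma * nat_tail P (X n)], and the immigrants, independent of it, add
their own tail. *)
Lemma generation_asymp n : regvar (nat_tail P (X n)) gamma ->
  let f x := m `^ gamma * nat_tail P (X n) x + nat_tail P (eps 0%N) x in
  asymp_le (nat_tail P (X n.+1)) f /\ asymp_le f (nat_tail P (X n.+1)).
Proof.
move=> Xn f.
have m0 := offspring_mean_gt0.
have mX : nat_measurable (X n) by exact: measurable_preimage_nat.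
have mxi0 : nat_measurable (xi 0%N 0%N) by exact: measurable_preimage_nat.
have mxi k : nat_measurable (xi n k) by exact: measurable_preimage_nat.
have meps : nat_measurable (eps n) by exact: measurable_preimage_nat.
have mS k : nat_measurable (partial_sum (xi n) k) by exact: measurable_offspring_sum hX n k.
have mSN : nat_measurable (fun w => partial_sum (xi n) (X n w) w).
  exact: measurable_random_sum hX n.
have law k A : pr P (xi n k @^-1` A) = pr P (xi 0%N 0%N @^-1` A).
  by have := gwi_offspring hX n k (A := A) I; rewrite /pr /distribution /pushforward => ->.
have Sxi k A B : pr P (partial_sum (xi n) k @^-1` A `&` xi n k @^-1` B) =
    pr P (partial_sum (xi n) k @^-1` A) * pr P (xi n k @^-1` B).
  by apply: prI; [exact: mS|exact: mxi|exact: offspring_sum_indep hX n k A B].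
have XS k A B : pr P (X n @^-1` A `&` partial_sum (xi n) k @^-1` B) =
    pr P (X n @^-1` A) * pr P (partial_sum (xi n) k @^-1` B).
  by apply: prI; [exact: mX|exact: mS|exact: current_offspring_indep hX n k A B].
have [r rg hr] := hxi.
have r0 : 0 < r by move: rg; rewrite gt_max => /andP[r1 _]; lra.
have [K xi_tail] := moment_tail hr r0.
have mge := partial_mean_le offspring_finite_mean.
have mlim := partial_mean_gt offspring_finite_mean.
set G := nat_tail P (fun w => partial_sum (xi n) (X n w) w).
have G1 : asymp_le G (fun x => m `^ gamma * nat_tail P (X n) x).
  exact: (random_sum_asymp_le mX mxi0 mxi mS mSN law Sxi XS m0 mge hgamma rg xi_tail Xn).
have G2 : asymp_le (fun x => m `^ gamma * nat_tail P (X n) x) G.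
  exact: (random_sum_asymp_ge mX mxi0 mxi mS mSN law Sxi XS m0 mlim hgamma Xn).
have epsE : nat_tail P (eps n) = nat_tail P (eps 0%N).
  exact: nat_tail_law (gwi_immigration hX n).
have mg : 0 < m `^ gamma by exact: powR_gt0.
have rvG : regvar G gamma.
  exact: regvar_asymp (nat_tail_nonincreasing P mSN) (regvarZ mg Xn) G1 G2.
have stepE : nat_tail P (X n.+1) =
    nat_tail P (fun w => partial_sum (xi n) (X n w) w + eps n w)%N.
  apply/funext => x; rewrite /nat_tail; congr pr.
  by apply/seteqP; split => w /=; rewrite (gwi_step hX).
have indep A B : pr P ((fun w => partial_sum (xi n) (X n w) w) @^-1` A `&` eps n @^-1` B) =
   pr P ((fun w => partial_sum (xi n) (X n w) w) @^-1` A) * pr P (eps n @^-1` B).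
  by apply: prI; [exact: mSN|exact: meps|exact: random_sum_immigration_indep hX n A B].
have rve : regvar (nat_tail P (eps n)) gamma by rewrite epsE.
have van := near_nat_tail_le (eps n).
have S1 := indep_sum_asymp_le mSN meps indep hgamma rvG rve van.
have S2 := indep_sum_asymp_ge mSN meps indep rvG rve van.
have e0 x : 0 <= nat_tail P (eps 0%N) x by exact: pr_ge0.
have refl : asymp_le (nat_tail P (eps 0%N)) (nat_tail P (eps 0%N)).
  by apply: asymp_le_near => //; near=> x.
rewrite stepE; rewrite epsE in S1 S2; split.
- apply: asymp_le_trans S1 (asymp_leD G1 refl) => x.
  by rewrite addr_ge0 // mulr_ge0 ?pr_ge0 ?powR_ge0.
- apply: asymp_le_trans (asymp_leD G2 refl) S2 => x; exact: pr_ge0.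
Unshelve. all: by end_near. Qed.

End OneStep.

Theorem proposition2p6 (d : measure_display) (T : measurableType d)
    (R : realType) (P : probability T R)
    (X : nat -> {RV P >-> nat}) (xi : nat -> nat -> {RV P >-> nat})
    (eps : nat -> {RV P >-> nat}) (gamma : R)
    (hX : galton_watson_immigration P X xi eps)
    (hgamma : 0 <= gamma)
    (hX0 : regularly_varying P (natRV P (X 0%N)) gamma)
    (heps : regularly_varying P (natRV P (eps 0%N)) gamma)
    (hxi0 : (P [set w : T | xi 0%N 0%N w = 0%N] < 1)%E)
    (hxi : exists2 r : R, Num.max 1 gamma < r
       & ('E_P[fun w => ((xi 0%N 0%N w)%:R `^ r)%R] < +oo)%E)
    (n : nat) (hn : (1 <= n)%N) :
  let m_xi := fine 'E_P[natRV P (xi 0%N 0%N)] in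
  asymp_equiv (tail P (natRV P (X n)))
    (fun x => m_xi `^ (n%:R * gamma) * tail P (natRV P (X 0%N)) x +
       \sum_(1 <= i < n.+1)
         m_xi `^ ((n - i)%N%:R * gamma) * tail P (natRV P (eps 0%N)) x)
  /\ regularly_varying P (natRV P (X n)) gamma.
Proof.
move=> m.
rewrite !tail_natRV regularly_varying_natP.
move/regularly_varying_natP in hX0; move/regularly_varying_natP in heps.
have m0 : 0 < m by exact: offspring_mean_gt0 hxi0 hxi.
pose g k x := m `^ (k%:R * gamma) * nat_tail P (X 0%N) x +
  \sum_(1 <= i < k.+1) m `^ ((k - i)%N%:R * gamma) * nat_tail P (eps 0%N) x.
have [F0 _] := hX0; have [E0 _] := heps.
have g_gt0 k x : 0 < g k x.
  apply: ltr_wpDr; last by rewrite mulr_gt0 // powR_gt0.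
  by apply: sumr_ge0 => i _; rewrite mulr_ge0 ?powR_ge0 // ltW.
have gS k x : g k.+1 x = m `^ gamma * g k x + nat_tail P (eps 0%N) x.
  have pS (j : nat) : m `^ (j.+1%:R * gamma) = m `^ gamma * m `^ (j%:R * gamma).
    rewrite -powRD; last by rewrite (gt_eqF m0) implybT.
    by rewrite -natr1 mulrDl mul1r addrC.
  rewrite /g pS big_nat_recr //= subnn mul0r powRr0 mul1r addrA mulrDr mulrA.
  congr (_ + _ + _); rewrite mulr_sumr; apply: eq_big_nat => i /andP[i1 ik].
  by rewrite subSn // pS mulrA.
have key k : regvar (nat_tail P (X k)) gamma /\
    asymp_le (nat_tail P (X k)) (g k) /\ asymp_le (g k) (nat_tail P (X k)).
  elim: k => [|k [rv [IH1 IH2]]].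
    have -> : g 0%N = nat_tail P (X 0%N).
      by apply/funext => x; rewrite /g big_geq // addr0 mul0r powRr0 mul1r.
    have refl : asymp_le (nat_tail P (X 0%N)) (nat_tail P (X 0%N)).
      by apply: asymp_le_near => [x|]; [exact: pr_ge0|near=> x].
    by [].
  have [S1 S2] := generation_asymp hX hgamma heps hxi0 hxi rv.
  have mg : 0 < m `^ gamma by exact: powR_gt0.
  have refl : asymp_le (nat_tail P (eps 0%N)) (nat_tail P (eps 0%N)).
    by apply: asymp_le_near => [x|]; [exact: pr_ge0|near=> x].
  have -> : g k.+1 = fun x => m `^ gamma * g k x + nat_tail P (eps 0%N) x.
    by apply/funext => x.
  have tail0 x : 0 <= nat_tail P (X k.+1) x by exact: pr_ge0.
  split; last split.
  - apply: regvar_asymp (regvarD (regvarZ mg rv) heps) S1 S2.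
    by apply: nat_tail_nonincreasing; exact: measurable_preimage_nat.
  - apply: asymp_le_trans S1 _ => [x|].
      by rewrite addr_ge0 ?mulr_ge0 ?powR_ge0 // ltW.
    by apply: asymp_leD refl; apply: asymp_leZ => //; exact: ltW.
  - apply: asymp_le_trans _ S2 => //.
    by apply: asymp_leD refl; apply: asymp_leZ => //; exact: ltW.
have [rv [k1 k2]] := key n; split=> //.
exact: (asymp_equivP (nat_tail P (X n)) (g_gt0 n)).2 (conj k1 k2).
Unshelve. all: by end_near. Qed.
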